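(* For every integer $n\geq 134$ there exists a planar $K_2$-hypohamiltonian graph of order $n$.
   Context: All graphs are finite, simple and connected. A graph is hamiltonian if it has a cycle through all its vertices. A graph $G$ is $K_2$-hamiltonian if for every pair of adjacent vertices $u,v$ the graph $G-u-v$ is hamiltonian; it is $K_2$-hypohamiltonian if it is $K_2$-hamiltonian and not hamiltonian. *)

(* Defs.v *)
From HB Require Import structures.
From mathcomp Require Import all_boot all_order all_algebra.
From mathcomp Require Import all_classical all_reals all_analysis.

Set Implicit Arguments.
Unset Strict Implicit.
Unset Printing Implicit Defensive.

Import Order.TTheory GRing.Theory Num.Theory.
Import numFieldNormedType.Exports.

Local Open Scope classical_set_scope.
Local Open Scope ring_scope.

Record sgraph := SGraph {
  vertex :> finType;
  adj : rel vertex;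
  adj_sym : symmetric adj;
  adj_irrefl : irreflexive adj }.

Arguments adj {_}.

Definition connected_graph (G : sgraph) : Prop :=
  forall x y : G, connect adj x y.

Section Deletion.
Variables (G : sgraph) (A : {set G}).

Definition del_vertex : finType := {x : G | x \notin A}.

Definition del_adj : rel del_vertex := fun x y => adj (val x) (val y).

Lemma del_adj_sym : symmetric del_adj.
Proof. by move=> x y; apply: adj_sym. Qed.

Lemma del_adj_irrefl : irreflexive del_adj.
Proof. by move=> x; apply: adj_irrefl. Qed.

Definition del_vertices : sgraph := SGraph del_adj_sym del_adj_irrefl.

End Deletion.

(* The length bound rules out the degenerate closed walks [:: x; y] that
   [cycle] accepts. *)
Definition hamiltonian (G : sgraph) : Prop :=
  exists c : seq G,
    [/\ (3 <= size c)%N, ucycle adj c & forall x : G, x \in c].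

Definition K2_hamiltonian (G : sgraph) : Prop :=
  forall u v : G, adj u v -> hamiltonian (del_vertices [set u; v]%SET).

Definition K2_hypohamiltonian (G : sgraph) : Prop :=
  K2_hamiltonian G /\ ~ hamiltonian G.

(* A drawing in the plane sends the vertex x to the point [pos x] and the edge
   uv to the simple arc [arc u v], parametrized by [0, 1] from u to v; [arc v u]
   is the same arc run backwards. *)
Record planar_drawing (R : realType) (G : sgraph)
    (pos : G -> R * R) (arc : G -> G -> R -> R * R) : Prop := PlanarDrawing {
  pos_inj : injective pos;
  arc_source : forall u v, adj u v -> arc u v 0 = pos u;
  arc_target : forall u v, adj u v -> arc u v 1 = pos v;
  arc_rev : forall u v, adj u v ->
    forall t : R, 0 <= t <= 1 -> arc v u t = arc u v (1 - t);
  arc_continuous : forall u v, adj u v ->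
    {within `[0, 1], continuous (arc u v)};
  arc_inj : forall u v, adj u v ->
    forall s t : R, 0 <= s <= 1 -> 0 <= t <= 1 -> arc u v s = arc u v t -> s = t;
  arc_avoids_vertices : forall u v, adj u v ->
    forall (t : R) (w : G), 0 < t < 1 -> arc u v t <> pos w;
  arc_disjoint : forall u v x y, adj u v -> adj x y ->
    [set u; v]%SET != [set x; y]%SET ->
    forall s t : R, 0 < s < 1 -> 0 < t < 1 -> arc u v s <> arc x y t }.

Definition planar (R : realType) (G : sgraph) : Prop :=
  exists (pos : G -> R * R) (arc : G -> G -> R -> R * R),
    planar_drawing pos arc.

(* Main.v *)
(* A graph is read off a word of operations [(p, a, b)], one for each vertex: sweeping a line
   from left to right over a planar drawing, the edges cut by the line form a list of strands, the
   next vertex absorbs the [a] strands starting at position [p] and emits [b] new ones there.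
   Sending vertex [t] to the abscissa [t] and letting every edge follow its strand gives a planar
   drawing, since the order of the strands never changes.

   A set of disjoint paths covering the vertices met so far is recorded by a state labelling the
   strands used by the paths, two strands having the same label when they continue the same path;
   [None] stands for a closed cycle. Extending the states vertex by vertex decides hamiltonicity,
   and skipping two vertices decides it for the graph without them.

   The words used consist of a left cap with 37, 75 or 113 vertices, any number of copies of a loop
   with 30 vertices having 8 strands at both ends, and one of ten right caps with 15, 18, ..., 42
   vertices; their sizes cover all n >= 134. Finite sets of states at the 8-strand cut are invariant
   under the loop: one contains all states reachable when nothing is deleted, and no right cap
   closes any of them; the others are reachable when a vertex or an edge is deleted, and all right
   caps complete them to a hamiltonian cycle. *)

From mathcomp Require Import all_boot zify.

Set Implicit Arguments.
Unset Strict Implicit.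
Unset Printing Implicit Defensive.

(** * Words and states *)

(** The two halves of the claim need the states in opposite ways. For the graph without [u] and [v]
    it is enough that a recorded state comes from an actual path system, so soundness is proved for
    any set [D] of deleted vertices and the computation may follow a few well-chosen states. For
    non-hamiltonicity no path system may escape, so completeness is proved, with [D] empty, and the
    computation follows a superset of all reachable states. The obstacle is that the deleted edge
    may lie anywhere in a chain of unbounded length, and its ends may lie in different pieces. At a
    cut there are therefore three situations: nothing deleted so far, only the source of one of the
    eight strands deleted, or both ends deleted. An edge crossing the cut is met in the second
    situation, at the strand that it uses. One finite family of states for each situation, carried
    through a single loop, settles all lengths. *)

Definition op := (nat * nat * nat)%type.
Notation word := (seq op).

(* The strands are listed by the vertex from which they come. *)
Definition strand_step (v : nat) (L : seq nat) (o : op) : seq nat :=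
  let: (p, a, b) := o in take p L ++ nseq b v ++ drop (p + a) L.
Definition absorbed (L : seq nat) (o : op) : seq nat :=
  let: (p, a, b) := o in take a (drop p L).
Fixpoint strands (v : nat) (L : seq nat) (W : word) : seq nat :=
  if W is o :: W' then strands v.+1 (strand_step v L o) W' else L.

(** The label 0 marks a strand that no path uses. *)
Definition nz (x : nat) := x != 0.
Definition labels (s : seq nat) := undup (filter nz s).

(* Renames the nonzero labels to 1, 2, ... in the order of their first occurrence. *)
Fixpoint norm_rec (d s : seq nat) : seq nat :=
  if s is x :: s' then
    if x is 0 then 0 :: norm_rec d s'
    else let i := index x d in
         if i < size d then i.+1 :: norm_rec d s'
         else (size d).+1 :: norm_rec (rcons d x) s'
  else [::].
Definition norm := norm_rec [::].

Definition emit1 (b l : nat) : seq (seq nat) :=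
  [seq nseq x 0 ++ l :: nseq (b - x.+1) 0 | x <- iota 0 b].
Definition emit2 (b l : nat) : seq (seq nat) :=
  flatten [seq [seq nseq x 0 ++ l :: e | e <- emit1 (b - x.+1) l] | x <- iota 0 b].
Definition fresh (s : seq nat) := (foldr maxn 0 s).+1.
Definition merge_labels (l l' x : nat) := if x == l' then l else x.

Notation state := (option (seq nat)).

(** Each vertex has two edges in the path system, so the used strands that it absorbs decide what it
    emits: two strands with a fresh label, one strand continuing the path, or none when two paths
    meet. Two equal labels close a cycle, which has to be the only component. After [None] no
    further vertex can be covered, whereas [skip_step] keeps [None]. *)
Definition cover_step (o : op) (s : state) : seq state :=
  if s is Some s then
    let: (p, a, b) := o in
    let pre := take p s in let post := drop (p + a) s in
    match filter nz (take a (drop p s)) with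
    | [::] => [seq Some (norm (pre ++ e ++ post)) | e <- emit2 b (fresh s)]
    | [:: l] => [seq Some (norm (pre ++ e ++ post)) | e <- emit1 b l]
    | [:: l; l'] =>
        if l == l' then if has nz (pre ++ post) then [::] else [:: None]
        else [:: Some (norm (map (merge_labels l l') (pre ++ nseq b 0 ++ post)))]
    | _ => [::]
    end
  else [::].
Definition skip_step (o : op) (s : state) : seq state :=
  if s is Some s then
    let: (p, a, b) := o in
    if has nz (take a (drop p s)) then [::]
    else [:: Some (take p s ++ nseq b 0 ++ drop (p + a) s)]
  else [:: None].

Lemma mem_labels s l : (l \in labels s) = nz l && (l \in s).
Proof. by rewrite mem_undup mem_filter. Qed.

(** [d'] is the dictionary after the last entry. Appending to a dictionary does not change the index
    of a label already in it, so the whole output can be read off [d']. *)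
Lemma norm_recE d s : uniq d -> exists2 d', uniq d' /\ {subset filter nz s <= d'} &
   (exists t, d' = d ++ t) /\
   norm_rec d s = [seq if x == 0 then 0 else (index x d').+1 | x <- s].
Proof.
elim: s d => [|x s IH] d ud /=; first by exists d => //; split => //; exists [::]; rewrite cats0.
case: x => [|x] /=.
  have [d' [ud' sd'] [[t E1] E2]] := IH d ud.
  by exists d'; split=> //; [exists t | rewrite E2].
case: ifP => [lt|/negbT ge].
  have [d' [ud' sd'] [[t E1] E2]] := IH d ud.
  have xd : x.+1 \in d by rewrite -index_mem.
  exists d'; split=> //.
    by move=> y; rewrite inE => /orP[/eqP->|/sd'//]; rewrite E1 mem_cat xd.
  by exists t.
  by rewrite E2 E1 index_cat xd.
have xd : x.+1 \notin d by rewrite -index_mem.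
have [|d' [ud' sd'] [[t E1] E2]] := IH (rcons d x.+1); first by rewrite rcons_uniq xd.
exists d'; split=> //.
- by move=> y; rewrite inE => /orP[/eqP->|/sd'//]; rewrite E1 mem_cat mem_rcons inE eqxx.
- by exists (x.+1 :: t); rewrite E1 cat_rcons.
- by rewrite E2 E1 index_cat mem_rcons inE eqxx /= -cats1 index_cat (negbTE xd) /= eqxx addn0.
Qed.

Definition relabeling (g : nat -> nat) (s : seq nat) :=
  {in s &, injective g} /\ {in s, forall x, nz (g x) = nz x}.

Lemma norm_relabel s : exists2 g, relabeling g s & norm s = map g s.
Proof.
have [d' [ud sd] [_ E]] := @norm_recE [::] s isT.
exists (fun x => if x == 0 then 0 else (index x d').+1); last by [].
split => [x y xs ys|x xs]; last by rewrite /nz; case: (x == 0).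
case: (eqVneq x 0) => [->|x0]; case: (eqVneq y 0) => [->|y0] //.
case=> E'; have xd : x \in d' by apply: sd; rewrite mem_filter /nz x0.
have yd : y \in d' by apply: sd; rewrite mem_filter /nz y0.
by rewrite -(nth_index 0 xd) E' nth_index.
Qed.

Lemma norm_rec_map g d s : {in d ++ s &, injective g} -> {in s, forall x, nz (g x) = nz x} ->
  norm_rec (map g d) (map g s) = norm_rec d s.
Proof.
elim: s d => [|x s IH] d //= gi g0.
have Hs : {in s, forall x, nz (g x) = nz x} by move=> y ys; apply: g0; rewrite inE ys orbT.
have E1 : norm_rec (map g d) (map g s) = norm_rec d s.
  apply: IH => // y z yd zd; apply: gi.
    by move: yd; rewrite !mem_cat inE => /orP[->|->]; rewrite ?orbT.
  by move: zd; rewrite !mem_cat inE => /orP[->|->]; rewrite ?orbT.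
have := g0 x (mem_head _ _); rewrite /nz.
case: x gi g0 => [|x] gi g0.
  by case E: (g 0) => [|y] // _; rewrite E1.
case E: (g x.+1) => [|y] // _.
have Ei : index y.+1 (map g d) = index x.+1 d.
  have : {in d, forall z, (g z == y.+1) = (z == x.+1)}.
    move=> z zd; rewrite -E; apply/eqP/eqP => [|-> //]; apply: gi; rewrite mem_cat.
      by rewrite zd.
    by rewrite mem_head orbT.
  rewrite /index; elim: (d) => [|z d' IHd] //= Hz.
  rewrite Hz ?mem_head // IHd // => w wd; apply: Hz; by rewrite inE wd orbT.
rewrite Ei size_map; case: ifP => _; first by rewrite E1.
congr (_ :: _); rewrite -E -map_rcons; apply: IH => // y' z.
rewrite !cat_rcons => A B; exact: gi.
Qed.

Lemma norm_map g s : relabeling g s -> norm (map g s) = norm s.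
Proof. by case=> gi g0; apply: (@norm_rec_map g [::]). Qed.

Lemma zero_nz l : nz l -> (0 == l) = false.
Proof. by rewrite eq_sym => /negbTE. Qed.

Lemma emit1P b l e : nz l -> size e = b -> count_mem l e = 1 ->
  {in e, forall x, nz x -> x = l} -> e \in emit1 b l.
Proof.
move=> l0 se c1 He.
have le : l \in e by rewrite -has_pred1 has_count c1.
case/splitPr: e / le se c1 He => e1 e2 se; rewrite count_cat /= eqxx add1n addnS => -[c1] He.
have z1 : e1 = nseq (size e1) 0.
  apply/all_pred1P/allP => x xe; apply: contraT => x0.
  have E : x = l by apply: He => //; rewrite mem_cat xe.
  have : 0 < count_mem l e1 by rewrite -has_count has_pred1 -E.
  by move/eqP: c1; rewrite addn_eq0 => /andP[/eqP E1 /eqP E2]; rewrite ?E1 ?E2.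
have z2 : e2 = nseq (size e2) 0.
  apply/all_pred1P/allP => x xe; apply: contraT => x0.
  have E : x = l by apply: He => //; rewrite mem_cat inE xe !orbT.
  have : 0 < count_mem l e2 by rewrite -has_count has_pred1 -E.
  by move/eqP: c1; rewrite addn_eq0 => /andP[/eqP E1 /eqP E2]; rewrite ?E1 ?E2.
apply/mapP; exists (size e1); first by rewrite mem_iota -se size_cat /=; lia.
rewrite {1}z1 {1}z2; congr (_ ++ _ :: nseq _ _); rewrite -se size_cat /=; lia.
Qed.

Lemma emit2P b l e : nz l -> size e = b -> count_mem l e = 2 ->
  {in e, forall x, nz x -> x = l} -> e \in emit2 b l.
Proof.
move=> l0 se c2 He.
have le : l \in e by rewrite -has_pred1 has_count c2.
set k := index l e; have kb : k < b by rewrite -se index_mem.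
have E : e = take k e ++ l :: drop k.+1 e.
  by rewrite -{1}(cat_take_drop k e) (drop_nth 0) ?index_mem // nth_index.
have z1 : take k e = nseq k 0.
  have sk : size (take k e) = k by rewrite size_takel // se ltnW.
  rewrite -{2}sk; apply/all_pred1P/allP => x xe; apply: contraT => x0.
  have xl : x = l by apply: He => //; apply: mem_take xe.
  have := index_ltn xe; rewrite -/k; move: xe; rewrite xl => /mem_take _.
  by rewrite /k ltnn.
apply/flattenP; exists [seq nseq k 0 ++ l :: e' | e' <- emit1 (b - k.+1) l].
  by apply/mapP; exists k => //; rewrite mem_iota.
apply/mapP; exists (drop k.+1 e); last by rewrite -z1.
apply: emit1P => //; first by rewrite size_drop se.
  by move: c2; rewrite {1}E count_cat /= eqxx z1 count_nseq /= zero_nz // mul0n => -[].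
by move=> x xe; apply: He; apply: mem_drop xe.
Qed.

Lemma emit1_mem b l e : e \in emit1 b l ->
  [/\ size e = b, nz l -> count_mem l e = 1 & {in e, forall x, nz x -> x = l}].
Proof.
case/mapP => x; rewrite mem_iota /= add0n => xb ->; split.
- by rewrite size_cat /= !size_nseq; lia.
- by move=> l0; rewrite count_cat /= !count_nseq /= zero_nz // eqxx !mul0n.
- move=> y; rewrite mem_cat inE !mem_nseq /nz.
  by case/or3P => [/andP[_ /eqP->]|/eqP->|/andP[_ /eqP->]].
Qed.

Lemma emit2_mem b l e : e \in emit2 b l ->
  [/\ size e = b, nz l -> count_mem l e = 2 & {in e, forall x, nz x -> x = l}].
Proof.
case/flattenP => ? /mapP[x]; rewrite mem_iota /= add0n => xb -> /mapP[e' /emit1_mem[s1 s2 s3] ->].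
split.
- by rewrite size_cat /= size_nseq s1; lia.
- by move=> l0; rewrite count_cat /= count_nseq /= zero_nz // eqxx mul0n add0n s2.
- move=> y; rewrite mem_cat inE mem_nseq /nz.
  case/or3P => [/andP[_ /eqP->]|/eqP->|ye] // y0; exact: s3.
Qed.

Lemma fresh_notin s : fresh s \notin s.
Proof.
suff H : forall x, x \in s -> x < fresh s by apply/negP => /H; rewrite ltnn.
elim: s => [|y s IH] // x; rewrite inE /fresh /= => /orP[/eqP->|/IH]; rewrite ?/fresh; lia.
Qed.

(** * Soundness of the states *)

(* The sources of the strands of [L] labelled [l] in the state [s]. *)
Definition ends (L s : seq nat) l := [seq x.1 | x <- zip L s & x.2 == l].

Lemma ends_cat L1 L2 s1 s2 l : size L1 = size s1 ->
  ends (L1 ++ L2) (s1 ++ s2) l = ends L1 s1 l ++ ends L2 s2 l.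
Proof. by move=> E; rewrite /ends zip_cat // filter_cat map_cat. Qed.

Lemma ends_cons x L y s l : ends (x :: L) (y :: s) l = (if y == l then [:: x] else [::]) ++ ends L s l.
Proof. by rewrite /ends /=; case: eqP. Qed.

Lemma ends_nseq b v e l : size e = b -> ends (nseq b v) e l = nseq (count_mem l e) v.
Proof.
by move=> <-; elim: e => [|y e IH] //=; rewrite ends_cons IH; case: eqP.
Qed.

Lemma size_ends L s l : size L = size s -> size (ends L s l) = count_mem l s.
Proof.
elim: L s => [|x L IH] [|y s] //= [E]; rewrite ends_cons size_cat IH //.
by case: eqP.
Qed.

Lemma mem_ends L s l u : u \in ends L s l -> u \in L.
Proof.
elim: L s => [|x L IH] [|y s] //=; rewrite ends_cons mem_cat inE.
by case/orP => [|/IH ->]; [case: eqP => // _; rewrite inE => -> | rewrite orbT].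
Qed.

Lemma ends_map g L s l : {in l :: s &, injective g} -> ends L (map g s) (g l) = ends L s l.
Proof.
elim: L s => [|x L IH] [|y s] //= gi; rewrite !ends_cons IH; last first.
  by move=> a b A B; apply: gi; [move: A|move: B]; rewrite !inE => /orP[]->; rewrite ?orbT.
suff -> : (g y == g l) = (y == l) by [].
by apply/eqP/eqP => [|-> //]; apply: gi; rewrite !inE eqxx ?orbT.
Qed.

Lemma ends_merge L s l l' : l != l' -> size L = size s ->
  perm_eq (ends L (map (merge_labels l l') s) l) (ends L s l ++ ends L s l').
Proof.
move=> ne; elim: L s => [|x L IH] [|y s] //= [E]; rewrite !ends_cons /merge_labels.
case: (eqVneq y l') => [->|yl'].
  by rewrite eqxx eq_sym (negbTE ne) /= perm_sym -cat1s perm_catCA /= perm_cons perm_sym IH.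
case: (eqVneq y l) => [_|_] /=; last exact: IH.
by rewrite perm_cons IH.
Qed.

Lemma ends_merge_other L s l l' k : k != l -> k != l' ->
  ends L (map (merge_labels l l') s) k = ends L s k.
Proof.
move=> kl kl'; elim: L s => [|x L IH] [|y s] //=; rewrite !ends_cons IH /merge_labels.
case: (eqVneq y l') => [->|//].
by rewrite ![_ == k]eq_sym (negbTE kl) (negbTE kl').
Qed.

Lemma subseq_ends L s l : subseq (ends L s l) L.
Proof.
elim: L s => [|x L IH] [|y s] //.
rewrite ends_cons; case: (y == l); rewrite /= ?eqxx //.
exact: subseq_trans (IH s) (subseq_cons _ _).
Qed.

Lemma perm_eq_sym (T : eqType) (s t : seq T) : perm_eq s t -> perm_eq t s.
Proof. by rewrite perm_sym. Qed.

Section Conf.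
Variable e : rel nat.
Hypothesis e_sym : symmetric e.

(** A path with a single vertex has both ends there: then [E] lists this vertex twice, for the two
    strands leaving it. *)
Definition path_ends (E q : seq nat) :=
  exists x p, [/\ q = x :: p, path e x p & perm_eq E [:: x; last x p]].

Lemma path_rev_belast x p : path e x p -> path e (last x p) (rev (belast x p)).
Proof.
move=> xp; rewrite rev_path.
by rewrite (eq_path (e' := e)) // => y z; exact: e_sym.
Qed.

Lemma last_rev_belast (x : nat) p : last (last x p) (rev (belast x p)) = x.
Proof. by case: p => [|y p] //=; rewrite rev_cons last_rcons. Qed.

Lemma perm_eq_1 (x : nat) s : perm_eq s [:: x] -> s = [:: x].
Proof. by move=> H; apply: perm_small_eq => //; rewrite (perm_size H). Qed.

(** Reversing the path if necessary puts the absorbed end [u] first, ready to be joined to the new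
    vertex. *)
Lemma path_ends_orient E u E0 q : path_ends E q -> perm_eq E (u :: E0) ->
  exists p, [/\ path e u p, perm_eq (u :: p) q & E0 = [:: last u p]].
Proof.
case=> x [p [-> xp E1]] E2.
have {E1 E2} E : perm_eq (u :: E0) [:: x; last x p] by rewrite -(permPl E2).
have : u \in [:: x; last x p] by rewrite -(perm_mem E) mem_head.
rewrite !inE => /orP[/eqP ux|/eqP ux].
  exists p; split; rewrite ?ux //.
  by apply: perm_eq_1; move: E; rewrite ux perm_cons.
exists (rev (belast x p)); rewrite ux; split; first exact: path_rev_belast.
  rewrite (lastI x p) -cats1 perm_sym -cat1s perm_catC perm_cat2l perm_sym.
  by rewrite perm_rev.
rewrite last_rev_belast; apply: perm_eq_1.
move: E; rewrite ux => /permPl E; rewrite -(perm_cons (last x p)) E.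
by rewrite -[X in perm_eq X _]/([:: x] ++ [:: last x p]) perm_catC.
Qed.

Definition undeleted (D : seq nat) (t : nat) := [seq u <- iota 0 t | u \notin D].

(* [P l] is the path recorded by the label [l] of [s]; the paths partition the vertices below [t]
   outside [D]. *)
Definition conf (D : seq nat) t (L s : seq nat) (P : nat -> seq nat) :=
  [/\ size s = size L, {in labels s, forall l, path_ends (ends L s l) (P l)} &
    perm_eq (flatten [seq P l | l <- labels s]) (undeleted D t)].

Lemma undeletedS D t : undeleted D t.+1 = undeleted D t ++ (if t \in D then [::] else [:: t]).
Proof. by rewrite /undeleted -addn1 iotaD filter_cat /= add0n; case: (t \in D). Qed.

Lemma perm_flatten_map (T : eqType) (P : nat -> seq T) s1 s2 : perm_eq s1 s2 ->
  perm_eq (flatten [seq P l | l <- s1]) (flatten [seq P l | l <- s2]).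
Proof. by move=> H; apply/perm_flatten/perm_map. Qed.

Lemma labels_perm s r : uniq r -> (forall l, (l \in r) = nz l && (l \in s)) -> perm_eq (labels s) r.
Proof. by move=> ur Hr; apply: uniq_perm; rewrite ?undup_uniq // => l; rewrite mem_labels Hr. Qed.

Lemma conf_relabel D t L s P g : relabeling g s -> conf D t L s P ->
  exists P', conf D t L (map g s) P'.
Proof.
case=> gi g0 [H1 H2 H3].
(* [P'] is [P] composed with the inverse of [g] on the labels. *)
pose P' l := P (nth 0 (labels s) (index l (map g (labels s)))).
have ls l : l \in labels s -> l \in s by rewrite mem_labels => /andP[].
have gil : {in labels s &, injective g} by move=> x y /ls xs /ls ys; apply: gi.
have ul : uniq (map g (labels s)) by rewrite map_inj_in_uniq ?undup_uniq.
have P'g l : l \in labels s -> P' (g l) = P l.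
  move=> ll; rewrite /P'; congr P; set i := index _ _.
  have il : i < size (labels s) by rewrite -(size_map g) index_mem map_f.
  by apply: gil; rewrite ?mem_nth // -(nth_map 0 0) // nth_index // map_f.
have pl : perm_eq (labels (map g s)) (map g (labels s)).
  apply: labels_perm => // l; apply/mapP/andP => [[x]|[l0 /mapP[x xs E]]].
    by rewrite mem_labels => /andP[x0 xs] ->; rewrite g0 // map_f.
  by exists x => //; rewrite mem_labels xs -g0 // -E l0.
exists P'; split; first by rewrite size_map.
  move=> l; rewrite (perm_mem pl) => /mapP[x xl ->].
  rewrite P'g // ends_map; first exact: H2.
  by move=> y z; rewrite !inE => /orP[/eqP->|ys] /orP[/eqP->|zs]; apply: gi => //; exact: ls.
rewrite (permPl (perm_flatten_map P' pl)) -map_comp.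
by have -> : map (P' \o g) (labels s) = map P (labels s) by apply/eq_in_map => l /P'g.
Qed.

Lemma conf_norm D t L s P : conf D t L s P -> exists P', conf D t L (norm s) P'.
Proof. by have [g rg ->] := norm_relabel s; apply: conf_relabel. Qed.

Definition closed_conf (D : seq nat) t :=
  exists c, [/\ cycle e c, perm_eq c (undeleted D t) & 3 <= size c].

Definition confs (D : seq nat) t L (s : state) :=
  if s is Some s then exists P, conf D t L s P else closed_conf D t.

Lemma split3 (T : Type) p a (s : seq T) : s = take p s ++ take a (drop p s) ++ drop (p + a) s.
Proof. by rewrite addnC -drop_drop cat_take_drop cat_take_drop. Qed.

Lemma ends_block0 L s l : size L = size s -> nz l -> l \notin filter nz s -> ends L s l = [::].
Proof.
move=> E l0 H; apply: size0nil; rewrite size_ends //; apply/count_memPn.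
by move: H; rewrite mem_filter l0.
Qed.

Lemma has_nzN s l : ~~ has nz s -> nz l -> l \notin s.
Proof. by move=> /hasPn H l0; apply/negP => /H; rewrite l0. Qed.

Lemma skip_sound D v L s P o s1 : v \in D -> (let: (p, a, b) := o in p + a <= size L) ->
  conf D v L s P -> s1 \in skip_step o (Some s) -> confs D v.+1 (strand_step v L o) s1.
Proof.
case: o => [[p a] b] vD wf [H1 H2 H3] /=.
case: ifP => // /negbT Hb; rewrite inE => /eqP -> /=.
have El : perm_eq (labels (take p s ++ nseq b 0 ++ drop (p + a) s)) (labels s).
  apply: labels_perm; first exact: undup_uniq.
  move=> l; rewrite mem_labels; case: (boolP (nz l)) => //= l0.
  rewrite {1}(split3 p a s) !mem_cat mem_nseq (negbTE (has_nzN Hb l0)) /=.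
  by rewrite -(negbK (l == 0)) -/(nz l) l0 andbF.
have sz : size (take p s) = size (take p L) by rewrite !size_take H1.
have szb : size (take a (drop p s)) = size (take a (drop p L)) by rewrite !size_take !size_drop H1.
exists P; split.
- by rewrite !size_cat !size_drop !size_nseq sz H1.
- move=> l ll; have l0 : nz l by move: ll; rewrite mem_labels => /andP[].
  rewrite (perm_mem El) in ll; have := H2 l ll.
  rewrite {1}(split3 p a L) {1}(split3 p a s) !ends_cat ?size_nseq //.
  rewrite (@ends_block0 (take a _)) ?ends_nseq ?size_nseq //.
    by rewrite count_nseq /= zero_nz // mul0n.
  by rewrite mem_filter (negbTE (has_nzN Hb l0)) andbF.
- by rewrite (permPl (perm_flatten_map P El)) undeletedS vD cats0.
Qed.

Lemma cover_sound D v L s P o s1 : v \notin D -> (let: (p, a, b) := o in p + a <= size L) ->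
  uniq (absorbed L o) -> {in absorbed L o, forall u, e u v} ->
  conf D v L s P -> s1 \in cover_step o (Some s) -> confs D v.+1 (strand_step v L o) s1.
Proof.
case: o => [[p a] b] vD wf uLB eLB [H1 H2 H3] /=.
set pre := take p s; set post := drop (p + a) s; set blk := take a (drop p s).
set L1 := take p L; set L2 := drop (p + a) L; set LB := absorbed L (p, a, b).
have sz1 : size pre = size L1 by rewrite !size_take H1.
have szb : size blk = size LB by rewrite /= !size_take !size_drop H1.
have sz2 : size post = size L2 by rewrite !size_drop H1.
have Es : s = pre ++ blk ++ post by exact: split3.
have EL : L = L1 ++ LB ++ L2 by exact: split3.
(* The ends of the path [l] outside the absorbed block; they survive the step. *)
pose O l := ends L1 pre l ++ ends L2 post l.
have EE l : perm_eq (ends L s l) (ends LB blk l ++ O l).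
  by rewrite Es EL !ends_cat //; rewrite perm_catCA.
have EE' pre' e' post' l : size pre' = size pre -> size e' = b -> size post' = size post ->
    perm_eq (ends (L1 ++ nseq b v ++ L2) (pre' ++ e' ++ post') l)
            (nseq (count_mem l e') v ++ ends L1 pre' l ++ ends L2 post' l).
  move=> S1 S2 S3; rewrite !ends_cat ?size_nseq ?S1 ?S2 //.
  by rewrite ends_nseq // perm_catCA.
have sizeS pre' e' post' : size pre' = size pre -> size e' = b -> size post' = size post ->
    size (pre' ++ e' ++ post') = size (L1 ++ nseq b v ++ L2).
  by move=> S1 S2 S3; rewrite !size_cat size_nseq S1 S2 S3 sz1 sz2.
have undS : undeleted D v.+1 = undeleted D v ++ [:: v] by rewrite undeletedS (negbTE vD).
have blkO l : nz l -> l \notin filter nz blk -> ends LB blk l = [::] by move=> l0; apply: ends_block0.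
have memlab l : (l \in labels s) = nz l && ((l \in filter nz blk) || (l \in pre ++ post)).
  rewrite mem_labels {1}Es; case: (boolP (nz l)) => //= l0.
  by rewrite !mem_cat mem_filter l0 /=; case: (l \in pre); rewrite ?orbT.
have blk1 l : nz l -> count_mem l blk = 1 -> exists2 u, u \in LB & ends LB blk l = [:: u].
  move=> l0 c1; have := size_ends l (esym szb); rewrite c1.
  case E: (ends LB blk l) => [|u [|]] // _; exists u => //.
  by apply: (@mem_ends _ blk l); rewrite E mem_head.
have cntb l : nz l -> count_mem l blk = count_mem l (filter nz blk).
  by move=> l0; rewrite count_filter; apply: eq_count => x /=; case: eqP => //= ->; rewrite l0.
case EB: (filter nz blk) => [|l [|l' [|]]] //.
- case/mapP => e' /emit2_mem [se ce ze] -> /=; set f := fresh s in se ce ze.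
  have f0 : nz f by []. have fs : f \notin s := fresh_notin s.
  apply: (@conf_norm D v.+1 _ _ (fun l => if l == f then [:: v] else P l)).
  have pl : perm_eq (labels (pre ++ e' ++ post)) (f :: labels s).
    apply: labels_perm => [|l].
      by rewrite /= undup_uniq mem_labels (negbTE fs) andbF.
    rewrite inE memlab EB /= !mem_cat; case: (eqVneq l f) => [->|lf] /=.
      by rewrite ?f0 -[f \in e']has_pred1 has_count ce //= orbT.
    case: (boolP (nz l)) => //= l0; case: (boolP (l \in e')) => [le|_]; last by rewrite orFb.
    by move: lf; rewrite (ze _ le l0) eqxx.
  split; first exact: sizeS.
    move=> l; rewrite (perm_mem pl) inE => /orP[/eqP->|ll].
      rewrite eqxx; exists v, [::]; split=> //.
      rewrite (permPl (EE' _ _ _ _ _ se _)) // ce //=.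
      have fO : ends L s f = [::].
        by apply: size0nil; rewrite size_ends //; apply/count_memPn.
      have := perm_size (EE f); rewrite fO size_cat => /esym/eqP.
      by rewrite addn_eq0 => /andP[_ /nilP]; rewrite /O => ->.
    have l0 : nz l by move: ll; rewrite memlab => /andP[].
    have lf : l != f by apply: contraNneq fs => <-; move: ll; rewrite mem_labels => /andP[].
    rewrite (negbTE lf); case: (H2 l ll) => x [q [Eq pq Ep]]; exists x, q; split=> //.
    rewrite (permPl (EE' _ _ _ _ _ se _)) // (count_memPn _) /=; last first.
      by apply/negP => le; move: lf; rewrite (ze _ le l0) eqxx.
    by move: (EE l); rewrite (blkO l l0) ?EB // => /permPl EEl; rewrite -/(O l) -EEl.
  rewrite (permPl (perm_flatten_map _ pl)) /= eqxx undS perm_catC perm_cat2r.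
  have <- // : map P (labels s) = map (fun l => if l == f then [:: v] else P l) (labels s).
  apply/eq_in_map => l ll.
  by case: eqP => // lf; move: ll fs; rewrite lf mem_labels => /andP[_ ->].
- case/mapP => e' /emit1_mem [se ce ze] -> /=.
  have l0 : nz l by have := mem_head l [::]; rewrite -EB mem_filter => /andP[].
  have ll : l \in labels s by rewrite memlab EB mem_head l0.
  have [|u uLBu Eu] := blk1 l l0; first by rewrite cntb // EB /= eqxx.
  have [|q [pq Eq Eo]] := path_ends_orient (E := ends L s l) (u := u) (E0 := O l) (H2 l ll).
    by rewrite -cat1s -Eu; exact: EE.
  have le : l \in e' by rewrite -has_pred1 has_count ce.
  pose P' k := if k == l then v :: u :: q else P k.
  apply: (@conf_norm D v.+1 _ _ P').
  have pl : perm_eq (labels (pre ++ e' ++ post)) (labels s).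
    apply: labels_perm => [|k]; first exact: undup_uniq.
    rewrite memlab EB inE !mem_cat; case: (boolP (nz k)) => //= k0.
    have -> : (k \in e') = (k == l).
      by apply/idP/eqP => [ke|->] //; exact: ze.
    by case: (k == l); rewrite ?orbT.
  split; first exact: sizeS.
    move=> k; rewrite (perm_mem pl) /P' => kl; have k0 : nz k by move: kl; rewrite memlab => /andP[].
    case: eqP => [->|/eqP kl'].
      exists v, (u :: q); split => //; first by rewrite /= e_sym eLB.
      by rewrite (permPl (EE' _ _ _ _ _ se _)) // ce // -/(O l) Eo.
    case: (H2 k kl) => x [r [Er pr Ep]]; exists x, r; split=> //.
    rewrite (permPl (EE' _ _ _ _ _ se _)) // (count_memPn _) /=; last first.
      by apply/negP => ke; move: kl'; rewrite (ze _ ke k0) eqxx.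
    move: (EE k); rewrite (blkO k k0) ?EB ?inE // => /permPl EEk.
    by rewrite -/(O k) -EEk.
  have pr := perm_to_rem ll.
  rewrite (permPl (perm_flatten_map _ pl)) (permPl (perm_flatten_map _ pr)) /= {1}/P' eqxx undS.
  have -> : map P' (rem l (labels s)) = map P (rem l (labels s)).
    apply/eq_in_map => k; rewrite mem_rem_uniq ?undup_uniq // inE => /andP[kl _].
    by rewrite /P' (negbTE kl).
  have H4 := perm_trans (perm_eq_sym (perm_flatten_map P pr)) H3.
  apply/permP => x; move/permP/(_ x): H4; move/permP/(_ x): Eq.
  by rewrite /= !count_cat /= => E1 E2; rewrite addn0 -E2 -E1 [RHS]addnC -!addnA.
- have l0 : nz l by have := mem_head l [:: l']; rewrite -EB mem_filter => /andP[].
  have l'0 : nz l'.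
    have : l' \in filter nz blk by rewrite EB !inE eqxx orbT.
    by rewrite mem_filter => /andP[].
  have ll : l \in labels s by rewrite memlab EB mem_head l0.
  have ll' : l' \in labels s by rewrite memlab EB !inE eqxx orbT l'0.
  case: (eqVneq l l') EB => [<-|ne] EB.
    case: ifP => // /negbT Hn; rewrite inE => /eqP -> /=.
    have Opp k : nz k -> O k = [::].
      move=> k0; rewrite /O; have := has_nzN Hn k0; rewrite mem_cat => /norP[k1 k2].
      by apply: size0nil; rewrite size_cat !size_ends // (count_memPn k1) (count_memPn k2).
    have := size_ends l (esym szb); rewrite cntb // EB /= eqxx.
    case Eu: (ends LB blk l) => [|u [|u' [|]]] // _.
    (* As no source is absorbed twice, the path has two different ends, so closing it at [v] gives a
       cycle of length at least 3. *)
    have uu : uniq [:: u; u'] by rewrite -Eu; apply: subseq_uniq uLB; exact: subseq_ends.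
    have [|q [pq Eq Eo]] := path_ends_orient (E := ends L s l) (u := u) (E0 := [:: u']) (H2 l ll).
      by have := EE l; rewrite Eu Opp // cats0.
    have uLBu : u \in LB by apply: (@mem_ends _ blk l); rewrite Eu mem_head.
    have uLBu' : u' \in LB by apply: (@mem_ends _ blk l); rewrite Eu !inE eqxx orbT.
    exists (v :: u :: q); split.
    + rewrite /= rcons_path e_sym eLB //= pq /=.
      by case: Eo => <-; rewrite eLB.
    + have pl : perm_eq (labels s) [:: l].
        apply: labels_perm => // k; have := memlab k; rewrite mem_labels => ->.
        rewrite EB !inE orbb; case: (boolP (nz k)) => k0 /=; last first.
          by apply/negbTE; apply: contraNneq k0 => ->.
        by rewrite (negbTE (has_nzN Hn k0)) orbF.
      rewrite undS -cat1s perm_catC perm_cat2r (permPl Eq) -(permPr H3).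
      by rewrite (permPr (perm_flatten_map P pl)) /= cats0.
    + by case: q Eo {pq Eq} uu => //= -[->]; rewrite inE eqxx.
  rewrite inE => /eqP -> /=.
  have [|u uLBu Eu] := blk1 l l0; first by rewrite cntb // EB /= eqxx eq_sym (negbTE ne).
  have [|u' uLBu' Eu'] := blk1 l' l'0; first by rewrite cntb // EB /= eqxx (negbTE ne).
  have [|q [pq Eq Eo]] := path_ends_orient (E := ends L s l) (u := u) (E0 := O l) (H2 l ll).
    by rewrite -cat1s -Eu; exact: EE.
  have [|q' [pq' Eq' Eo']] := path_ends_orient (E := ends L s l') (u := u') (E0 := O l') (H2 l' ll').
    by rewrite -cat1s -Eu'; exact: EE.
  set g := merge_labels l l'.
  have -> : map g (pre ++ nseq b 0 ++ post) = map g pre ++ nseq b 0 ++ map g post.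
    by rewrite !map_cat map_nseq {2}/g /merge_labels zero_nz.
  (* The path [l] backwards as far as [u], then [v], then the path [l'] from [u'] on. *)
  pose P' k := if k == l then last u q :: rev (belast u q) ++ v :: u' :: q' else P k.
  apply: (@conf_norm D v.+1 _ _ P').
  have gk k k' : nz k -> (k \in map g k') = (k != l') && ((k \in k') || (k == l) && (l' \in k')).
    move=> k0; apply/mapP/idP => [[x xs ->]|].
      rewrite /g /merge_labels; case: (eqVneq x l') xs => [-> l's|xl' xs].
        by rewrite ne eqxx l's orbT.
      by rewrite xl' xs.
    case/andP => kl' /orP[kk|/andP[/eqP-> l'k]].
      by exists k; rewrite // /g /merge_labels (negbTE kl').
    by exists l'; rewrite // /g /merge_labels eqxx.
  have pl : perm_eq (labels (map g pre ++ nseq b 0 ++ map g post)) (rem l' (labels s)).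
    apply: labels_perm => [|k]; first by rewrite rem_uniq ?undup_uniq.
    rewrite mem_rem_uniq ?undup_uniq // [_ \in [predD1 _ & _]]inE /= memlab EB !inE.
    case: (boolP (nz k)) => k0; rewrite ?andbF //= !mem_cat !gk // mem_nseq.
    rewrite [k == 0](negbTE k0) andbF /=.
    case: (eqVneq k l') => //= kl'; case: (eqVneq k l) => [->|]; rewrite ?orbF //=.
    (* The label [l] does not vanish: the far end of its path is outside the absorbed block. *)
    have /orP[->|->] : (l \in pre) || (l \in post); rewrite ?orbT //.
    apply: contraT => /norP[n1 n2]; have := Eo; rewrite /O.
    have/nilP -> : nilp (ends L1 pre l) by rewrite /nilp size_ends // (count_memPn n1).
    by have/nilP -> : nilp (ends L2 post l) by rewrite /nilp size_ends // (count_memPn n2).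
  split; first by rewrite sizeS ?size_map ?size_nseq.
    move=> k; rewrite (perm_mem pl) mem_rem_uniq ?undup_uniq // inE /= => /andP[kl' kl].
    have k0 : nz k by move: kl; rewrite memlab => /andP[].
    have EEk : perm_eq (ends (L1 ++ nseq b v ++ L2) (map g pre ++ nseq b 0 ++ map g post) k)
       (ends L1 (map g pre) k ++ ends L2 (map g post) k).
      rewrite (permPl (EE' _ _ _ _ _ _ _)) ?size_map ?size_nseq //.
      by rewrite count_nseq /= zero_nz.
    rewrite /P'; case: eqP => [Ek|/eqP kl2].
      exists (last u q), (rev (belast u q) ++ v :: u' :: q'); split=> //.
        by rewrite cat_path path_rev_belast //= last_rev_belast eLB //= e_sym eLB.
      rewrite (permPl EEk) Ek last_cat /=.
      have /permPl -> : perm_eq (ends L1 (map g pre) l ++ ends L2 (map g post) l) (O l ++ O l').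
        rewrite (permPl (perm_cat (ends_merge ne (esym sz1)) (ends_merge ne (esym sz2)))).
        by rewrite /O -!catA perm_cat2l perm_catCA.
      by rewrite Eo Eo'.
    case: (H2 k kl) => x [r [Er pr' Ep]]; exists x, r; split=> //.
    rewrite (permPl EEk) /g !ends_merge_other // -/(O k).
    move: (EE k); rewrite (blkO k k0) ?EB ?inE ?negb_or ?kl2 // => /permPl EEk'.
    by rewrite -EEk'.
  have pr := perm_to_rem ll'.
  have lr : l \in rem l' (labels s) by rewrite mem_rem_uniq ?undup_uniq // inE /= ne.
  have pr2 := perm_to_rem lr.
  rewrite (permPl (perm_flatten_map _ pl)) (permPl (perm_flatten_map _ pr2)) /= {1}/P' eqxx undS.
  have -> : map P' (rem l (rem l' (labels s))) = map P (rem l (rem l' (labels s))).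
    apply/eq_in_map => k; rewrite mem_rem_uniq ?rem_uniq ?undup_uniq // inE => /andP[kl _].
    by rewrite /P' (negbTE kl).
  set R := flatten _.
  have H4 : perm_eq (P l' ++ (P l ++ R)) (undeleted D v).
    rewrite -(permPr H3) (permPr (perm_flatten_map _ pr)) /= perm_cat2l.
    by rewrite (permPr (perm_flatten_map _ pr2)).
  apply/permP => x; move/permP/(_ x): H4; move/permP/(_ x): Eq'; move/permP/(_ x): Eq.
  have : count x (last u q :: rev (belast u q)) = count x (u :: q).
    by rewrite (lastI u q) -rev_rcons count_rev.
  have arith (lu r v1 u1 cq u2 cq' cR cD cP cP' : nat) : lu + r = u1 + cq -> u1 + cq = cP ->
      u2 + cq' = cP' -> cP' + (cP + cR) = cD ->
      lu + (r + (v1 + (u2 + cq')) + cR) = cD + (v1 + 0).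
    by clear; lia.
  rewrite /= !count_cat /=; first [exact: arith | rewrite -?addnA => E1 E2 E3 E4; match goal with |- ?G => idtac G end; match type of E4 with ?G => idtac G end].
Qed.
End Conf.

(** * Completeness of the states *)

Lemma emit1_map h b l : h 0 = 0 -> emit1 b (h l) = map (map h) (emit1 b l).
Proof.
move=> h0; rewrite /emit1 -map_comp; apply: eq_map => x /=.
by rewrite map_cat /= !map_nseq h0.
Qed.

Lemma emit2_map h b l : h 0 = 0 -> emit2 b (h l) = map (map h) (emit2 b l).
Proof.
move=> h0; rewrite /emit2 map_flatten -map_comp; congr flatten; apply: eq_map => x /=.
rewrite emit1_map // -map_comp -[in RHS]map_comp; apply: eq_map => y /=; by rewrite map_cat /= map_nseq h0.
Qed.

Lemma relabeling_sub g s t : {subset t <= s} -> relabeling g s -> relabeling g t.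
Proof. by move=> sub [gi g0]; split=> [x y /sub X /sub Y|x /sub]; [exact: gi|exact: g0]. Qed.

(** This makes it harmless to store normalized states only: the successors are normalized too, so
    the names of the labels leave no trace in them. *)
Lemma cover_relabel o g s : relabeling g s -> cover_step o (Some (map g s)) = cover_step o (Some s).
Proof.
case: o => [[p a] b] rg; case: (rg) => gi g0; rewrite /cover_step -map_take -map_drop -map_take -map_drop.
set pre := take p s; set post := drop (p + a) s; set blk := take a (drop p s).
have Es : s = pre ++ blk ++ post by exact: split3.
have spre : {subset pre <= s} by move=> x X; rewrite Es mem_cat X.
have sblk : {subset blk <= s} by move=> x X; rewrite Es !mem_cat X orbT.
have spost : {subset post <= s} by move=> x X; rewrite Es !mem_cat X !orbT.
have -> : filter nz (map g blk) = map g (filter nz blk).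
  by rewrite filter_map; congr map; apply: eq_in_filter => x /sblk /g0 /= ->.
have sf l : l \in filter nz blk -> l \in s /\ nz l by rewrite mem_filter => /andP[-> /sblk].
pose h x := if x == 0 then 0 else g x.
case EB: (filter nz blk) => [|l [|l' [|l2 r]]] //=.
- set f := fresh s; set f' := fresh (map g s).
  pose k x := if x == f then f' else if x == 0 then 0 else g x.
  have -> : f' = k f by rewrite /k eqxx.
  rewrite emit2_map // -map_comp; apply/eq_in_map => e /emit2_mem[_ _ He] /=.
  congr (Some _).
  have fs := fresh_notin s; have fs' := fresh_notin (map g s).
  pose k' x := if x == f then f' else g x.
  have rk : relabeling k' (f :: s).
    split=> [x y|x]; rewrite !inE /k'.
      case: (eqVneq x f) => [->|xf]; case: (eqVneq y f) => [->|yf] //=.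
      - by move=> _ ys E; case/negP: fs'; rewrite -/f' E map_f.
      - by move=> xs _ E; case/negP: fs'; rewrite -/f' -E map_f.
      - exact: gi.
    by case: (eqVneq x f) => [->|xf] //=; exact: g0.
  (* A relabeling is controlled on [s] only: if 0 is not in [s], then [g 0] is arbitrary, while the
     emitted block may contain 0. In that case [k], which fixes 0, is used instead of [k']. *)
  case: (boolP (0 \in s)) => s0.
    have kk' : {in f :: s, k =1 k'}.
      move=> x _; rewrite /k /k'; case: (x == f) => //; case: eqP => // ->.
      by apply/esym/eqP; move: (g0 _ s0); rewrite /nz eqxx => /negbT; rewrite negbK.
    have sube : {subset pre ++ e ++ post <= f :: s}.
      move=> x; rewrite !mem_cat inE => /or3P[/spre->|xe|/spost->]; rewrite ?orbT //.
      by case: (boolP (nz x)) => [/(He _ xe)->|]; rewrite ?eqxx // negbK => /eqP ->; rewrite s0 orbT.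
    rewrite -[RHS](norm_map (relabeling_sub sube rk)) !map_cat; congr norm.
    congr (_ ++ (_ ++ _)).
    + apply/eq_in_map => x /spre xs; rewrite /k'; case: eqP => // xf.
      by move: fs; rewrite -/f -xf xs.
    + apply/eq_in_map => x xe; apply: kk'; rewrite inE.
      case: (boolP (nz x)) => [/(He _ xe)->|]; rewrite ?eqxx // negbK => /eqP ->.
      by rewrite s0 orbT.
    + apply/eq_in_map => x /spost xs; rewrite /k'; case: eqP => // xf.
      by move: fs; rewrite -/f -xf xs.
  have g0' x : x \in s -> g x != 0.
    by move=> xs; have := g0 _ xs; rewrite /nz => ->; apply: contraNneq s0 => <-.
  have rk2 : relabeling k (0 :: f :: s).
    split=> [x y|x]; rewrite !inE /k.
      case: (eqVneq x f) => [->|xf]; case: (eqVneq y f) => [->|yf] //=.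
      - case: (eqVneq y 0) => [-> //|y0] /= _ ys E; case/negP: fs'; by rewrite -/f' E map_f.
      - case: (eqVneq x 0) => [-> //|y0] /= xs _ E; case/negP: fs'; by rewrite -/f' -E map_f.
      - case: (eqVneq x 0) => [->|x0]; case: (eqVneq y 0) => [->|y0] //=.
        + by move=> _ /g0' /eqP H /esym /H.
        + by move=> /g0' /eqP H _ /H.
        + exact: gi.
    case: (eqVneq x f) => [->|xf] //=; case: (eqVneq x 0) => [->|x0] //=.
    by move=> /g0' ; rewrite /nz x0 => ->.
  have sube : {subset pre ++ e ++ post <= 0 :: f :: s}.
    move=> x; rewrite !mem_cat !inE => /or3P[/spre->|xe|/spost->]; rewrite ?orbT //.
    by case: (boolP (nz x)) => [/(He _ xe)->|]; rewrite ?eqxx ?orbT // negbK => ->.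
  rewrite -[RHS](norm_map (relabeling_sub sube rk2)) !map_cat; congr norm.
  have kg : {in s, k =1 g}.
    move=> x xs; rewrite /k; case: eqP => [xf|_]; first by move: fs; rewrite -/f -xf xs.
    by case: eqP => // x0; move: s0; rewrite -x0 xs.
  congr (_ ++ (_ ++ _)); apply/eq_in_map => x xs; rewrite kg //; [exact: spre|exact: spost].
- have [|ls l0] := sf l; first by rewrite EB mem_head.
  have -> : g l = h l by rewrite /h (negbTE l0).
  rewrite emit1_map // -map_comp; apply/eq_in_map => e /emit1_mem[_ _ He] /=; congr (Some _).
  have rh : relabeling h (0 :: s).
    split=> [x y|x]; rewrite !inE /h.
      case: (eqVneq x 0) => [->|x0]; case: (eqVneq y 0) => [->|y0] //=.
      + by move=> _ ys E; have := g0 _ ys; rewrite /nz -E y0.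
      + by move=> xs _ E; have := g0 _ xs; rewrite /nz E x0.
      + exact: gi.
    by case: (eqVneq x 0) => [->|x0] //=; exact: g0.
  have sube : {subset pre ++ e ++ post <= 0 :: s}.
    move=> x; rewrite !mem_cat !inE => /or3P[/spre->|xe|/spost->]; rewrite ?orbT //.
    by case: (boolP (nz x)) => [/(He _ xe)->|]; rewrite ?ls ?orbT // negbK => ->.
  rewrite -[RHS](norm_map (relabeling_sub sube rh)) !map_cat; congr norm.
  have kg : {in s, h =1 g}.
    move=> x xs; rewrite /h; case: eqP => // x0; have := g0 _ xs.
    by rewrite /nz x0 => /negbT; rewrite negbK => /eqP.
  by congr (_ ++ (_ ++ _)); apply/eq_in_map => x xs; rewrite kg //; [exact: spre|exact: spost].
- have [|ls l0] := sf l; first by rewrite EB mem_head.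
  have [|ls' l0'] := sf l'; first by rewrite EB !inE eqxx orbT.
  rewrite (inj_in_eq gi) //; case: eqP => [_|/eqP ne].
    rewrite -map_cat has_map; congr (if _ then _ else _); apply: eq_in_has => x /=.
    by rewrite mem_cat => /orP[/spre|/spost] /g0.
  congr [:: Some _].
  have rh : relabeling h (0 :: s).
    split=> [x y|x]; rewrite !inE /h.
      case: (eqVneq x 0) => [->|x0]; case: (eqVneq y 0) => [->|y0] //=.
      + by move=> _ ys E; have := g0 _ ys; rewrite /nz -E y0.
      + by move=> xs _ E; have := g0 _ xs; rewrite /nz E x0.
      + exact: gi.
    by case: (eqVneq x 0) => [->|x0] //=; exact: g0.
  have kg : {in s, h =1 g}.
    move=> x xs; rewrite /h; case: eqP => // x0; have := g0 _ xs.
    by rewrite /nz x0 => /negbT; rewrite negbK => /eqP.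
  have sube : {subset pre ++ nseq b 0 ++ post <= 0 :: s}.
    move=> x; rewrite !mem_cat !inE => /or3P[/spre->| |/spost->]; rewrite ?orbT //.
    by rewrite mem_nseq => /andP[_ ->].
  have subm : {subset map (merge_labels l l') (pre ++ nseq b 0 ++ post) <= 0 :: s}.
    move=> x /mapP[y /sube ys ->]; rewrite /merge_labels.
    by case: eqP; rewrite // inE ls orbT.
  rewrite -[RHS](norm_map (relabeling_sub subm rh)); congr norm.
  have -> : map g pre ++ nseq b 0 ++ map g post = map h (pre ++ nseq b 0 ++ post).
    rewrite !map_cat map_nseq; congr (_ ++ (_ ++ _)).
      by apply/eq_in_map => x xs; rewrite kg //; exact: spre.
    by apply/eq_in_map => x xs; rewrite kg //; exact: spost.
  rewrite -!map_comp; apply/eq_in_map => x /sube xs /=; rewrite /merge_labels -!kg //.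
  have -> : (h x == h l') = (x == l').
    by apply/eqP/eqP => [|-> //]; apply: (proj1 rh); rewrite // inE ls' orbT.
  by case: (x == l').
Qed.

Lemma cover_norm o s : cover_step o (Some (norm s)) = cover_step o (Some s).
Proof. by have [g rg ->] := norm_relabel s; exact: cover_relabel. Qed.

Lemma ends_mapself f s k : ends s (map f s) k = [seq x <- s | f x == k].
Proof. by elim: s => [|x s IH] //=; rewrite ends_cons IH; case: eqP. Qed.

Lemma filter_pred2_ordered (T : eqType) (u u' : T) s : uniq s -> u \in s -> u' \in s ->
  index u s < index u' s -> filter (pred2 u u') s = [:: u; u'].
Proof.
move=> us uS; case/splitPr: uS us => s1 s2; rewrite cat_uniq /= negb_or => /and3P[_ /andP[u1 _] /andP[u2 us2]].
rewrite mem_cat inE !index_cat (negbTE u1) /= eqxx addn0.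
case: ifP => [u's1|u's1]; first by rewrite ltnNge index_size.
case: (eqVneq u' u) => [->|ne] /=; first by rewrite ?addn0 ltnn.
move=> u's2 _; rewrite filter_cat /= eqxx /=.
have -> : filter (pred2 u u') s1 = [::].
  apply/eqP; rewrite -(negbK (_ == _)) -has_filter; apply/hasPn => x xs /=.
  by apply/norP; split; apply/eqP => E; [move: u1|move: u's1]; rewrite -E xs.
congr (_ :: _); rewrite -(@filter_pred1_uniq _ s2 u') //; apply: eq_in_filter => x xs /=.
by case: (x =P u) => // E; move: u2; rewrite -E xs.
Qed.

Section Complete.
Variable e : rel nat.
Hypothesis e_sym : symmetric e.

Lemma path_ends_rev E q : path_ends e E q -> path_ends e E (rev q).
Proof.
case=> x [p [-> xp Ep]]; exists (last x p), (rev (belast x p)); split.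
- by rewrite (lastI x p) rev_rcons.
- exact: path_rev_belast.
- rewrite last_rev_belast (permPl Ep).
  by rewrite -[X in perm_eq X _]/([:: x] ++ [:: last x p]) perm_catC.
Qed.

(** The paths of a configuration have no direction; this allows the path through the new vertex to
    be read from either side. *)
Lemma conf_rev D t L s P l : conf e D t L s P ->
  conf e D t L s (fun k => if k == l then rev (P k) else P k).
Proof.
case=> H1 H2 H3; split=> //.
  by move=> k /H2 H; case: (k == l) => //; exact: path_ends_rev.
rewrite -(permPr H3); elim: (labels s) => [|k ks IH] //=.
by apply: perm_cat => //; case: (k == l) => //; rewrite perm_rev.
Qed.

Variables (v : nat) (L : seq nat) (p a b : nat).
Hypothesis wf : p + a <= size L.
Let L1 := take p L. Let L2 := drop (p + a) L. Let LB := take a (drop p L).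
Hypothesis uLB : uniq LB.
Hypothesis Lv : {in L, forall u, u < v}.
Hypothesis eLB : forall u, u < v -> e u v -> u \in LB.

Let EL : L = L1 ++ LB ++ L2. Proof. exact: split3. Qed.
Let sL1 : size L1 = p. Proof. by rewrite size_takel //; move: wf; lia. Qed.
Let sLB : size LB = a. Proof. by rewrite size_takel // size_drop; move: wf; lia. Qed.

Section Given.
Variables (s' : seq nat) (P : nat -> seq nat).
Hypothesis H : conf e [::] v.+1 (L1 ++ nseq b v ++ L2) s' P.
Let pre := take p s'. Let e' := take b (drop p s'). Let post := drop (p + b) s'.
Let O l := ends L1 pre l ++ ends L2 post l.

Lemma given_split : [/\ s' = pre ++ e' ++ post, size pre = p, size e' = b & size post = size L2].
Proof.
case: H => H1 _ _; rewrite !size_cat size_nseq sL1 in H1; split; first exact: split3.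
- by rewrite size_takel // H1; lia.
- by rewrite size_takel // size_drop H1; lia.
- by rewrite size_drop H1; lia.
Qed.

Lemma given_ends k : perm_eq (ends (L1 ++ nseq b v ++ L2) s' k) (nseq (count_mem k e') v ++ O k).
Proof.
have [-> s1 s2 s3] := given_split.
by rewrite !ends_cat ?size_nseq ?s1 ?s2 // ends_nseq // perm_catCA.
Qed.

Lemma given_vO k : v \notin O k.
Proof.
by apply/negP; rewrite mem_cat => /orP[] /mem_ends Hv;
  have := @Lv v; rewrite ltnn {1}EL !mem_cat Hv ?orbT => /(_ isT).
Qed.

Lemma given_label : exists2 l, l \in labels s' & v \in P l.
Proof.
have : v \in flatten [seq P l | l <- labels s'].
  by case: H => _ _ H3; rewrite (perm_mem H3) mem_filter mem_iota /= add0n.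
by case/flattenP => ? /mapP[l ll ->] vl; exists l.
Qed.

Variable l : nat.
Hypotheses (ll : l \in labels s') (vl : v \in P l).
Let rest := flatten [seq P k | k <- rem l (labels s')].

Lemma given_perm : perm_eq (P l ++ rest) (iota 0 v.+1).
Proof.
case: H => _ _ H3; have -> : iota 0 v.+1 = undeleted [::] v.+1 by rewrite /undeleted filter_predT.
by rewrite -(permPr H3) (permPr (perm_flatten_map P (perm_to_rem ll))).
Qed.

Lemma given_rest Q : perm_eq (P l) (v :: Q) -> perm_eq (Q ++ rest) (undeleted [::] v).
Proof.
move=> PQ; rewrite /undeleted filter_predT -(perm_cons v) -cat_cons.
have : perm_eq (P l ++ rest) ((v :: Q) ++ rest) by rewrite perm_cat2r.
move/permPl => <-; rewrite (permPl given_perm) -addn1 iotaD /= add0n.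
by rewrite -(cat1s v) perm_catC.
Qed.

Lemma given_uniqP : uniq (P l).
Proof. by have := perm_uniq given_perm; rewrite cat_uniq iota_uniq => /andP[]. Qed.

Lemma given_lt u : u \in P l -> u != v -> u < v.
Proof.
move=> uP uv; have : u \in P l ++ rest by rewrite mem_cat uP.
by rewrite (perm_mem given_perm) mem_iota /= add0n ltnS leq_eqVlt (negbTE uv).
Qed.

Lemma given_other k : k \in labels s' -> k != l -> count_mem k e' = 0 /\ path_ends e (O k) (P k).
Proof.
move=> lk kl; have [_ H2 _] := H; have [x [q [Eq xq Ep]]] := H2 k lk.
have vk : v \notin P k.
  apply/negP => vk; have : v \in rest.
    by apply/flattenP; exists (P k) => //; apply: map_f; rewrite mem_rem_uniq ?undup_uniq // inE kl.
  move=> vr; have := perm_uniq given_perm; rewrite iota_uniq cat_uniq => /and3P[_ /hasPn/(_ v vr)].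
  by rewrite /= vl.
have vE : v \notin ends (L1 ++ nseq b v ++ L2) s' k.
  apply: contra vk => vE; rewrite Eq; move: vE; rewrite (perm_mem Ep) !inE => /orP[->//|/eqP->].
  by have := mem_last x q; rewrite inE.
have c0 : count_mem k e' = 0.
  move: vE; rewrite (perm_mem (given_ends k)) mem_cat mem_nseq eqxx andbT.
  by case: (count_mem k e').
by split=> //; exists x, q; split=> //; rewrite -(permPr Ep) (permPr (given_ends k)) c0.
Qed.

Lemma given_e' x : x \in e' -> nz x -> x = l.
Proof.
move=> xe x0; apply/eqP; apply: contraT => xl.
have [Es _ _ _] := given_split.
have [||c0 _] := @given_other x => //; first by rewrite mem_labels x0 Es !mem_cat xe orbT.
by move: xe; rewrite -has_pred1 has_count c0.
Qed.

Lemma given_l : nz l. Proof. by move: ll; rewrite mem_labels => /andP[]. Qed.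

Lemma given_labels k : (k \in labels s') = nz k && ((k \in pre ++ post) || (k == l)).
Proof.
have [Es _ _ _] := given_split; rewrite mem_labels; case: (boolP (nz k)) => //= k0.
case: (eqVneq k l) => [->|kl]; first by move: ll; rewrite mem_labels orbT => /andP[].
rewrite {1}Es !mem_cat orbF; have -> // : (k \in e') = false.
by apply/negP => /given_e' /(_ k0) E; rewrite E eqxx in kl.
Qed.

Let goal := exists s P0, conf e [::] v L s P0 /\ Some (norm s') \in cover_step (p, a, b) (Some s).

Lemma sizeS (pre1 blk post1 : seq nat) : size pre1 = p -> size blk = a -> size post1 = size L2 ->
  size (pre1 ++ blk ++ post1) = size L.
Proof. by rewrite !size_cat => -> -> ->; rewrite size_drop; move: wf; lia. Qed.

Lemma given_cut (pre1 blk post1 : seq nat) : size pre1 = p -> size blk = a ->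
  [/\ take p (pre1 ++ blk ++ post1) = pre1, take a (drop p (pre1 ++ blk ++ post1)) = blk &
      drop (p + a) (pre1 ++ blk ++ post1) = post1].
Proof.
move=> <- <-; rewrite take_size_cat // drop_size_cat // take_size_cat //; split=> //.
by rewrite catA -size_cat drop_size_cat.
Qed.

Lemma case_new : P l = [:: v] -> goal.
Proof.
move=> El; have [Es s1 s2 s3] := given_split; have [_ H2 _] := H.
have [x [q [Eq xq Ep]]] := H2 l ll; rewrite El in Eq; case: Eq => Ex Eq; subst x q.
have cl : count_mem l e' = 2 /\ O l = [::].
  have := given_ends l; rewrite (permPl Ep) /= => E.
  have HO : O l = [::].
    case EO: (O l) => [|y r] //; have : y \in [:: v; v] by rewrite (perm_mem E) mem_cat EO mem_head orbT.
    rewrite !inE orbb => /eqP yv; by have := given_vO l; rewrite EO yv mem_head.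
  by split=> //; have := perm_size E; rewrite HO cats0 size_nseq.
case: cl => c2 Ol.
have lN : l \notin pre ++ post.
  rewrite mem_cat; apply/norP; move/nilP: Ol; rewrite /nilp /O size_cat !size_ends ?s1 // addn_eq0.
  by move=> /andP[/eqP A /eqP B]; split; apply/count_memPn.
have [c1 cb cp] := given_cut (blk := nseq a 0) post s1 (size_nseq _ _).
exists (pre ++ nseq a 0 ++ post), P; split; last first.
  rewrite /cover_step c1 cb cp filter_nseq /=.
  set f := fresh _; have fN := fresh_notin (pre ++ nseq a 0 ++ post); rewrite -/f in fN.
  (* The step chooses its own fresh label [f] where [s'] has [l]; [h] translates, and normalization
     removes the difference. *)
  pose h x := if x == l then f else x.
  have hid t : l \notin t -> map h t = t.
    move=> lt; rewrite -[RHS]map_id; apply/eq_in_map => x xt; rewrite /h.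
    by case: eqP => // xl; rewrite -xl xt in lt.
  apply/mapP; exists (map h e').
    have -> : f = h l by rewrite /h eqxx.
    rewrite emit2_map; last by rewrite /h zero_nz // given_l.
    by apply: map_f; apply: emit2P => //; [exact: given_l | exact: given_e'].
  congr Some; have -> : pre ++ map h e' ++ post = map h s'.
    by move: lN; rewrite Es !map_cat mem_cat => /norP[l1 l2]; rewrite (hid pre) ?(hid post).
  rewrite norm_map //; split=> [x y xs ys|x xs]; rewrite /h; last first.
    by case: eqP => // ->; rewrite given_l.
  have fs z : z \in s' -> z != l -> z != f.
    rewrite Es !mem_cat => zs zl; apply/eqP => zf; case/negP: fN; rewrite -zf !mem_cat.
    case/or3P: zs => [->//|ze|->]; rewrite ?orbT //.
    by move: zl; rewrite (given_e' ze) ?eqxx // zf.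
  case: (eqVneq x l) => [->|xl]; case: (eqVneq y l) => [->|yl] //.
    by move=> E; have := fs y ys yl; rewrite -E eqxx.
  by move=> E; have := fs x xs xl; rewrite E eqxx.
have pl : perm_eq (labels (pre ++ nseq a 0 ++ post)) (rem l (labels s')).
  apply: labels_perm => [|k]; first by rewrite rem_uniq ?undup_uniq.
  rewrite mem_rem_uniq ?undup_uniq // inE /= given_labels.
  case: (boolP (nz k)) => k0; rewrite ?andbF //=.
  rewrite !mem_cat mem_nseq [k == 0](negbTE k0) andbF /= -mem_cat.
  case: (eqVneq k l) => [->|kl] /=; last by rewrite orbF.
  by rewrite (negbTE lN).
split; first by rewrite sizeS ?size_nseq.
  move=> k; rewrite (perm_mem pl) mem_rem_uniq ?undup_uniq // inE => /andP[kl lk].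
  have [_] := given_other lk kl; case=> x [q [Eq xq' Ep']]; exists x, q; split=> //.
  rewrite EL !ends_cat ?size_nseq ?s1 // -(permPr Ep') /O perm_cat2l.
  rewrite (@ends_block0 LB) ?size_nseq //; first by move: lk; rewrite mem_labels => /andP[].
  by rewrite filter_nseq.
rewrite (permPl (perm_flatten_map P pl)) -[X in perm_eq X _]cat0s; apply: given_rest.
by rewrite El.
Qed.

Lemma case_end u q : P l = v :: u :: q -> goal.
Proof.
move=> El; have [Es s1 s2 s3] := given_split; have [_ H2 _] := H.
have [x [q' [Eq xq Ep]]] := H2 l ll; rewrite El in Eq; case: Eq => Ex Eq; subst x q'.
have uP := given_uniqP; rewrite El in uP.
have vlast : v != last u q.
  by move: uP => /= /andP[+ _]; apply: contraNneq => ->; have := mem_last u q.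
have [c1 Ol] : count_mem l e' = 1 /\ O l = [:: last u q].
  have := given_ends l; rewrite (permPl Ep) /= => E.
  have/permP/(_ (pred1 v)) := E; rewrite count_cat /= eqxx eq_sym (negbTE vlast) /= count_nseq /= eqxx mul1n.
  rewrite (count_memPn (given_vO l)) !addn0 => /esym c1; split=> //.
  move: E; rewrite c1 /= perm_cons => /perm_eq_sym E; exact: perm_eq_1.
have l0 := given_l.
have uv : u != v by move: uP; rewrite /= inE negb_or eq_sym => /andP[/andP[]].
have uLBu : u \in LB.
  apply: eLB; first by apply: given_lt => //; rewrite El !inE eqxx orbT.
  by rewrite e_sym; case/andP: xq.
(* Among the absorbed strands exactly the one from [u], the neighbour of [v] on the path, is
   used. *)
pose blk := [seq if x == u then l else 0 | x <- LB].
have sblk : size blk = a by rewrite size_map.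
have fb : filter nz blk = [:: l].
  rewrite filter_map (@eq_filter _ _ (pred1 u)) ?filter_pred1_uniq //= ?eqxx //.
  by move=> x /=; case: eqP => //; rewrite l0.
have eb k : nz k -> ends LB blk k = if k == l then [:: u] else [::].
  move=> k0; rewrite ends_mapself; case: eqVneq => [->|kl].
    rewrite (@eq_filter _ _ (pred1 u)) ?filter_pred1_uniq //.
    by move=> x /=; case: (x == u); rewrite ?eqxx // zero_nz.
  rewrite (@eq_filter _ _ pred0) ?filter_pred0 // => x /=.
  by case: (x == u); rewrite ?zero_nz // eq_sym (negbTE kl).
have [c1' cb cp] := given_cut post s1 sblk.
exists (pre ++ blk ++ post), (fun k => if k == l then u :: q else P k); split; last first.
  rewrite /cover_step c1' cb cp fb; apply/mapP; exists e'; last by rewrite -Es.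
  apply: emit1P => //; exact: given_e'.
have lb : (l \in blk) by have := mem_head l [::]; rewrite -fb mem_filter => /andP[].
have pl : perm_eq (labels (pre ++ blk ++ post)) (labels s').
  apply: labels_perm => [|k]; first by rewrite undup_uniq.
  rewrite given_labels; case: (boolP (nz k)) => k0 //=.
  rewrite !mem_cat; have -> : (k \in blk) = (k == l).
    by have := mem_filter nz k blk; rewrite fb inE k0 => ->.
  by case: (k \in pre); case: (k == l); case: (k \in post).
split; first by rewrite sizeS.
  move=> k; rewrite (perm_mem pl) => lk; have k0 : nz k by move: lk; rewrite mem_labels => /andP[].
  have EE : perm_eq (ends L (pre ++ blk ++ post) k) (ends LB blk k ++ O k).
    by rewrite {1}EL !ends_cat ?s1 ?sL1 ?sblk ?sLB // perm_catCA.
  case: eqVneq => [Ek|kl].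
    exists u, q; split=> //; first by case/andP: xq.
    by rewrite (permPl EE) Ek eb // eqxx Ol.
  have [_ [x [r [Er xr Er']]]] := given_other lk kl; exists x, r; split=> //.
  by rewrite (permPl EE) eb // (negbTE kl).
rewrite (permPl (perm_flatten_map _ (perm_trans pl (perm_to_rem ll)))) /= eqxx.
have -> : [seq if k == l then u :: q else P k | k <- rem l (labels s')] = [seq P k | k <- rem l (labels s')].
  by apply/eq_in_map => k; rewrite mem_rem_uniq ?undup_uniq // inE => /andP[/negbTE ->].
by apply: given_rest; rewrite El.
Qed.

(** Removing [v] cuts its path into two, ending at the absorbed strands from [u] and [u']. The step
    keeps the label of the strand absorbed first, so the half at that strand has to carry [l]; this
    is the origin of the condition on the indices. *)
Lemma case_mid u u' q1 q2 : P l = rcons q1 u ++ v :: u' :: q2 -> index u LB <= index u' LB -> goal.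
Proof.
move=> El iuu; have [Es s1 s2 s3] := given_split; have [_ H2 _] := H.
have [x [q [Eq xq Ep]]] := H2 l ll.
have uP := given_uniqP; rewrite El in uP.
pose y := last u' q2; pose w := head u (rcons q1 u).
have [Ew Ey] : x = w /\ last x q = y.
  rewrite /w /y; split; first by move: Eq; rewrite El; case: (q1) => [|z q1'] [].
  by have := congr1 (last v) Eq; rewrite El last_cat /= => ->.
have vN1 : v \notin rcons q1 u.
  by move: uP; rewrite cat_uniq => /and3P[_ /norP[]].
have vN2 : v \notin u' :: q2 by move: uP; rewrite cat_uniq => /and3P[_ _ /=/andP[]].
have wq : w \in rcons q1 u by rewrite /w; case: (q1) => [|z r] /=; rewrite inE eqxx.
have yq : y \in u' :: q2 by exact: mem_last.
have wy : w != y.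
  apply: contraTneq uP => wy; rewrite cat_uniq; apply/negP => /and3P[_ /hasPn/(_ w)].
  by rewrite inE wy yq orbT -wy wq => /(_ isT).
have pE : path e w (rcons (behead (rcons q1 u)) v ++ u' :: q2).
  have : x :: q = w :: (rcons (behead (rcons q1 u)) v ++ u' :: q2).
    by rewrite -Eq El /w; case: (q1) => [|z r] /=; rewrite ?cat_rcons.
  by case=> <- <-.
have Ew' : rcons q1 u = w :: behead (rcons q1 u) by rewrite /w; case: (q1).
have lastw : last w (behead (rcons q1 u)) = u.
  by have := congr1 (last v) Ew'; rewrite last_rcons.
move: pE; rewrite cat_path rcons_path last_rcons lastw /= => /and3P[/andP[pw euv] evu' pu'].
rewrite Ey Ew in Ep.
have [c0 Ol] : count_mem l e' = 0 /\ perm_eq (O l) [:: w; y].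
  have := given_ends l; rewrite (permPl Ep) => E.
  have c0 : count_mem l e' = 0.
    have : v \notin [:: w; y].
      by rewrite !inE; apply/norP; split; apply/eqP => E1; move: vN1 vN2; rewrite E1 ?wq ?yq.
    by rewrite (perm_mem E) mem_cat mem_nseq eqxx andbT; case: (count_mem l e').
  by split=> //; move: E; rewrite c0 /= perm_sym.
have l0 := given_l.
have inP z : z \in rcons q1 u ++ u' :: q2 -> z \in P l /\ z != v.
  move=> zz; split; first by rewrite El; move: zz; rewrite !mem_cat [_ \in v :: _]inE => /orP[->//|->]; rewrite !orbT.
  by apply/eqP => zv; move: zz; rewrite zv mem_cat (negbTE vN1) (negbTE vN2).
have uLBu : u \in LB.
  have [|uPl uv] := inP u; first by rewrite mem_cat mem_rcons mem_head.
  by apply: eLB => //; exact: given_lt.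
have uLBu' : u' \in LB.
  have [|uPl uv] := inP u'; first by rewrite mem_cat mem_head orbT.
  by apply: eLB; [exact: given_lt | rewrite e_sym].
have uu' : u != u'.
  apply: contraTneq uP => E; rewrite cat_uniq; apply/negP => /and3P[_ /hasPn/(_ u)].
  by rewrite !inE E eqxx orbT -E mem_rcons mem_head => /(_ isT).
have {}iuu : index u LB < index u' LB.
  rewrite ltn_neqAle iuu andbT; apply: contra uu' => /eqP E.
  by rewrite -(nth_index 0 uLBu) E nth_index.
pose f := fresh s'; have fN : f \notin s' := fresh_notin s'. have f0 : nz f by [].
have ls' : l \in s' by move: ll; rewrite mem_labels => /andP[].
have lf : l != f by apply: contraNneq fN => <-.
(* The path splits at [v]; its half ending in [y] receives the new label [f]. *)
pose tag (M t : seq nat) := [seq if (z.1 == y) && (z.2 == l) then f else z.2 | z <- zip M t].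
have stag M t : size t = size M -> size (tag M t) = size t by move=> E; rewrite size_map size_zip E minnn.
have untag M t : size t = size M -> f \notin t -> map (merge_labels l f) (tag M t) = t.
  elim: M t => [|m M IH] [|z t] //= [E]; rewrite inE negb_or => /andP[fz ft].
  rewrite IH // /merge_labels; case: (boolP (_ && _)) => [/andP[_ /eqP->]|_]; first by rewrite eqxx.
  by rewrite eq_sym (negbTE fz).
have etl M t : size t = size M -> f \notin t -> ends M (tag M t) l = [seq z <- ends M t l | z != y].
  elim: M t => [|m M IH] [|z t] //= [E]; rewrite inE negb_or => /andP[fz ft].
  rewrite !ends_cons filter_cat IH //; case: (eqVneq z l) => [->|zl]; last by rewrite andbF (negbTE zl).
  by rewrite /=; case: (m == y) => /=; rewrite ?eqxx // eq_sym (negbTE lf).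
have etf M t : size t = size M -> f \notin t -> ends M (tag M t) f = [seq z <- ends M t l | z == y].
  elim: M t => [|m M IH] [|z t] //= [E]; rewrite inE negb_or => /andP[fz ft].
  rewrite !ends_cons filter_cat IH //; case: (eqVneq z l) => [->|zl].
    by rewrite /=; case: (m == y) => /=; rewrite ?eqxx // (negbTE lf).
  by rewrite andbF eq_sym (negbTE fz).
have etk M t k : size t = size M -> k != l -> k != f -> ends M (tag M t) k = ends M t k.
  move=> + kl kf; elim: M t => [|m M IH] [|z t] //= [E]; rewrite !ends_cons IH //.
  rewrite /=; case: (boolP (_ && _)) => [/andP[_ /eqP->]|_] //.
  by rewrite ![_ == k]eq_sym (negbTE kf) (negbTE kl).
have fpre : f \notin pre by apply: contra fN; rewrite Es mem_cat => ->.
have fpost : f \notin post by apply: contra fN; rewrite Es !mem_cat => ->; rewrite !orbT.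
have s1' : size pre = size L1 by rewrite s1.
pose blk := [seq if z == u then l else if z == u' then f else 0 | z <- LB].
have sblk : size blk = a by rewrite size_map.
have fb : filter nz blk = [:: l; f].
  rewrite filter_map (@eq_filter _ _ (pred2 u u')).
    by rewrite filter_pred2_ordered //= eqxx eq_sym (negbTE uu') eqxx.
  by move=> z /=; case: eqP; rewrite ?l0 //; case: eqP.
have eb k : nz k -> ends LB blk k = if k == l then [:: u] else if k == f then [:: u'] else [::].
  move=> k0; rewrite ends_mapself; case: (eqVneq k l) => [->|kl].
    rewrite (@eq_filter _ _ (pred1 u)) ?filter_pred1_uniq // => z /=.
    by case: (z == u); rewrite ?eqxx //; case: (z == u'); rewrite ?zero_nz // eq_sym (negbTE lf).
  case: (eqVneq k f) => [->|kf].
    rewrite (@eq_filter _ _ (pred1 u')) ?filter_pred1_uniq // => z /=.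
    case: (eqVneq z u) => [->|_]; first by rewrite (negbTE lf) (negbTE uu').
    by case: (z == u'); rewrite ?eqxx ?zero_nz.
  rewrite (@eq_filter _ _ pred0) ?filter_pred0 // => z /=.
  case: (z == u); first by rewrite eq_sym (negbTE kl).
  by case: (z == u'); rewrite ?zero_nz // eq_sym (negbTE kf).
have [c1' cb cp] := @given_cut (tag L1 pre) blk (tag L2 post) (etrans (stag _ _ s1') s1) sblk.
pose P0 k := if k == l then rcons q1 u else if k == f then u' :: q2 else P k.
exists (tag L1 pre ++ blk ++ tag L2 post), P0; split; last first.
  rewrite /cover_step c1' cb cp fb (negbTE lf) inE; apply/eqP; congr (Some (norm _)).
  rewrite !map_cat !untag // Es map_nseq /merge_labels zero_nz //; congr (_ ++ _).
  congr (_ ++ _); rewrite -s2; apply/all_pred1P/allP => z ze; apply: contraT => z0.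
  have zl := given_e' ze z0; rewrite zl in ze.
  by move: ze; rewrite -has_pred1 has_count c0.
have ES : size (tag L1 pre ++ blk ++ tag L2 post) = size L.
  by rewrite sizeS // stag // ?s3.
have EE k : perm_eq (ends L (tag L1 pre ++ blk ++ tag L2 post) k)
    (ends LB blk k ++ ends L1 (tag L1 pre) k ++ ends L2 (tag L2 post) k).
  by rewrite {1}EL !ends_cat ?stag ?s1' ?sblk ?sLB // perm_catCA.
have lk k : k \in labels s' -> k != f.
  by rewrite mem_labels => /andP[_ ks]; apply: contraNneq fN => <-.
have eM k : nz k -> (k \in tag L1 pre ++ blk ++ tag L2 post) =
     (0 < size (ends L (tag L1 pre ++ blk ++ tag L2 post) k)).
  by move=> k0; rewrite size_ends // -has_count has_pred1.
have pl : perm_eq (labels (tag L1 pre ++ blk ++ tag L2 post)) (f :: labels s').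
  apply: labels_perm => [|k].
    by rewrite /= undup_uniq andbT; apply/negP => /lk; rewrite eqxx.
  rewrite inE given_labels; case: (boolP (nz k)) => k0 /=; last first.
    by rewrite orbF; apply/eqP => kf; rewrite kf in k0.
  rewrite eM // (perm_size (EE k)) eb //.
  case: (eqVneq k l) => [_|kl] /=; first by rewrite !orbT.
  case: (eqVneq k f) => [_|kf] //=.
  by rewrite !etk // size_cat !size_ends // orbF mem_cat -!has_pred1 !has_count addn_gt0.
split => //.
  move=> k; rewrite (perm_mem pl) inE => kk.
  have k0 : nz k by case/orP: kk => [/eqP->//|]; rewrite mem_labels => /andP[].
  rewrite /P0; case: (eqVneq k l) => [Ek|kl].
    exists w, (behead (rcons q1 u)); split=> //.
    rewrite (permPl (EE k)) Ek eb // eqxx !etl // -filter_cat lastw.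
    rewrite (permPl (perm_cat (perm_refl [:: u]) (perm_filter _ Ol))) /= wy eqxx /=.
    by rewrite (perm_catC [:: u] [:: w]).
  case: (eqVneq k f) kk => [Ek _|kf] /=.
    exists u', q2; split=> //.
    rewrite (permPl (EE k)) Ek eb // eq_sym (negbTE lf) eqxx !etf // -filter_cat.
    by rewrite (permPl (perm_cat (perm_refl [:: u']) (perm_filter _ Ol))) /= (negbTE wy) eqxx.
  move=> kk; have [_ [z [r [Er zr Er']]]] := given_other kk kl; exists z, r; split=> //.
  by rewrite (permPl (EE k)) eb // (negbTE kl) (negbTE kf) !etk.
have /permPl -> := perm_flatten_map P0 pl.
have /permPl -> : perm_eq (flatten [seq P0 k | k <- f :: labels s'])
    (flatten [seq P0 k | k <- f :: l :: rem l (labels s')]).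
  by apply: perm_flatten_map; rewrite perm_cons perm_to_rem.
rewrite /= {1 2}/P0 eq_sym (negbTE lf) !eqxx.
have -> : [seq P0 k | k <- rem l (labels s')] = [seq P k | k <- rem l (labels s')].
  apply/eq_in_map => k; rewrite mem_rem_uniq ?undup_uniq // inE => /andP[/negbTE kl kk].
  by rewrite /P0 kl (negbTE (lk _ kk)).
rewrite -/rest catA; apply: given_rest.
by rewrite El -[X in perm_eq _ X]/((v :: u' :: q2) ++ rcons q1 u) perm_catC.
Qed.
End Given.

(** The last vertex [v] is alone on its path, an end of it, or an inner vertex. Reversal reduces the
    second case to [v] being the first vertex and the third to the neighbours appearing in the order
    in which they are absorbed. *)
Lemma cover_complete s' P : conf e [::] v.+1 (L1 ++ nseq b v ++ L2) s' P ->
  exists s P0, conf e [::] v L s P0 /\ Some (norm s') \in cover_step (p, a, b) (Some s).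
Proof.
move=> H; have [l ll vl] := given_label H.
have Hr := conf_rev l H; set Pr := fun k => _ in Hr.
have Prl : Pr l = rev (P l) by rewrite /Pr eqxx.
have vr : v \in Pr l by rewrite Prl mem_rev.
have [q1 [q2 El]] : exists q1 q2, P l = q1 ++ v :: q2 by case/splitPr: vl => q1 q2; exists q1, q2.
have Elr : Pr l = rev q2 ++ v :: rev q1 by rewrite Prl El rev_cat rev_cons cat_rcons.
case: (lastP q1) El Elr => [|q u]; case: q2 => [|u' r] El Elr.
- exact: (@case_new s' P H l ll vl El).
- exact: (@case_end s' P H l ll vl u' r El).
- by apply: (@case_end s' Pr Hr l ll vr u (rev q)); rewrite Elr rev_rcons.
- case: (leqP (index u LB) (index u' LB)) => [le|/ltnW le]; first exact: (@case_mid s' P H l ll vl u u' q r El le).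
  by apply: (@case_mid s' Pr Hr l ll vr u' u (rev r) (rev q)) => //; rewrite Elr rev_rcons rev_cons.
Qed.

Lemma closed_complete : closed_conf e [::] v.+1 ->
  exists s P0, conf e [::] v L s P0 /\ None \in cover_step (p, a, b) (Some s).
Proof.
case=> c [cyc pc sc].
have vc : v \in c by rewrite (perm_mem pc) mem_filter mem_iota /= add0n.
have [i r Er] := rot_to vc.
have cyr : cycle e (v :: r) by rewrite -Er rot_cycle.
have pr : perm_eq r (iota 0 v).
  rewrite -(perm_cons v) -Er perm_rot (permPl pc) /undeleted filter_predT -addn1 iotaD /= add0n.
  by rewrite perm_catC.
have sr : 1 < size r by move: sc; rewrite -(size_rot i) Er.
case: r Er cyr pr sr => [|u [|u1 q]] // Er cyr pr _.
have ur : uniq (u :: u1 :: q) by rewrite (perm_uniq pr) iota_uniq.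
set u' := last u1 q; have u'q : u' \in u1 :: q by exact: mem_last.
have uu' : u != u' by apply: contraTneq ur => E; rewrite /= {1}E u'q.
move: cyr; rewrite /cycle rcons_path => /andP[/andP[evu pq] eu'v].
have lt z : z \in u :: u1 :: q -> z < v by rewrite (perm_mem pr) mem_iota add0n.
have uLBu : u \in LB by apply: eLB; [apply: lt; rewrite mem_head | rewrite e_sym].
have uLBu' : u' \in LB by apply: eLB; [apply: lt; rewrite inE u'q orbT | exact: eu'v].
(* Before the closing vertex the cycle is a single path from [u] to [u'], so the preceding state has
   one label, on these two absorbed strands. *)
pose blk := [seq if pred2 u u' z then 1 else 0 | z <- LB].
have [w [w' [Ef pw]]] : exists w w', filter (pred2 u u') LB = [:: w; w'] /\ perm_eq [:: w; w'] [:: u; u'].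
  case: (ltngtP (index u LB) (index u' LB)) => le.
  - by exists u, u'; rewrite filter_pred2_ordered.
  - exists u', u; split; last by rewrite (perm_catC [:: u'] [:: u]).
    by rewrite -(@filter_pred2_ordered _ u' u LB) //; apply: eq_filter => z /=; rewrite orbC.
  - by case/eqP: uu'; rewrite -(nth_index 0 uLBu) le nth_index.
have fb : filter nz blk = [:: 1; 1].
  rewrite filter_map (@eq_filter _ _ (pred2 u u')) ?Ef /=; last by move=> z /=; case: (_ || _).
  have : w \in [:: w; w'] by rewrite mem_head.
  have : w' \in [:: w; w'] by rewrite !inE eqxx orbT.
  by rewrite !(perm_mem pw) !inE => -> ->.
have sblk : size blk = a by rewrite size_map.
have n1 k : 1 \notin nseq k 0 by rewrite mem_nseq andbF.
have eb0 M k : size M = k -> ends M (nseq k 0) 1 = [::].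
  by move=> E; apply: size0nil; rewrite size_ends ?size_nseq // (count_memPn (n1 k)).
have [c1 cb cp] := given_cut (blk := blk) (nseq (size L2) 0) (size_nseq p 0) sblk.
exists (nseq p 0 ++ blk ++ nseq (size L2) 0), (fun=> u :: u1 :: q); split; last first.
  rewrite /cover_step c1 cb cp fb eqxx has_cat !has_nseq /= !andbF; exact: mem_head.
have b1 : 1 \in blk by have := mem_head 1 [:: 1]; rewrite -fb mem_filter => /andP[].
have pl : perm_eq (labels (nseq p 0 ++ blk ++ nseq (size L2) 0)) [:: 1].
  apply: labels_perm => // k; rewrite inE !mem_cat !mem_nseq.
  case: (boolP (nz k)) => k0 /=; last by apply/eqP => k1; rewrite k1 in k0.
  rewrite [k == 0](negbTE k0) !andbF /= orbF.
  by have := mem_filter nz k blk; rewrite fb !inE orbb k0.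
split.
- by rewrite !size_cat !size_nseq sblk size_drop; move: wf; clear; lia.
- move=> k; rewrite (perm_mem pl) inE => /eqP ->; exists u, (u1 :: q); split=> //.
  rewrite EL !ends_cat ?size_nseq ?sblk // !eb0 // cats0 ends_mapself -(permPr pw) -Ef.
  by rewrite (@eq_filter _ _ (pred2 u u')) // => z /=; case: (_ || _).
- by rewrite (permPl (perm_flatten_map _ pl)) /= cats0 /undeleted filter_predT.
Qed.
End Complete.

(** * Words as graphs *)

Definition frontier (W : word) t := strands 0 [::] (take t W).
Definition op_at (W : word) t : op := nth (0, 0, 0) W t.
Definition back (W : word) v := absorbed (frontier W v) (op_at W v).
Definition linked W u v := (u \in back W v) || (v \in back W u).

Definition fits (L : seq nat) (o : op) := let: (p, a, b) := o in p + a <= size L.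
(** The absence of repetitions in [back] excludes multiple edges, its non-emptiness gives
    connectedness, and the empty last frontier says that every strand has found its target. *)
Definition well_formed (W : word) :=
  (forall t, t < size W -> [/\ fits (frontier W t) (op_at W t), uniq (back W t) & 0 < t -> back W t != [::]])
  /\ frontier W (size W) = [::].

Lemma linked_sym W : symmetric (linked W). Proof. by move=> u v; rewrite /linked orbC. Qed.

Lemma strands_cat v L W1 W2 : strands v L (W1 ++ W2) = strands (v + size W1) (strands v L W1) W2.
Proof. by elim: W1 v L => [|o W1 IH] v L /=; rewrite ?addn0 // IH addSnnS. Qed.

Lemma take_op W t : t < size W -> take t.+1 W = rcons (take t W) (op_at W t).
Proof. by move=> tW; rewrite (take_nth (0, 0, 0)). Qed.

Lemma frontierS W t : t < size W -> frontier W t.+1 = strand_step t (frontier W t) (op_at W t).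
Proof. by move=> tW; rewrite /frontier take_op // -cats1 strands_cat /= add0n size_takel // ltnW. Qed.

Lemma frontier_lt W t : t <= size W -> {in frontier W t, forall u, u < t}.
Proof.
elim: t => [|t IH] tW u; first by rewrite /frontier take0.
rewrite frontierS // /strand_step; case: (op_at W t) => [[p a] b]; rewrite !mem_cat mem_nseq.
case/or3P => [/mem_take /(IH (ltnW tW))|/andP[_ /eqP->]|/mem_drop /(IH (ltnW tW))] //; lia.
Qed.

Lemma back_frontier W v u : u \in back W v -> u \in frontier W v /\ v < size W.
Proof.
rewrite /back; case: (leqP (size W) v) => [le|lt].
  by rewrite /op_at nth_default //= take0.
by case: (op_at W v) => [[p a] b] /mem_take /mem_drop.
Qed.

Lemma back_lt W v u : u \in back W v -> u < v < size W.
Proof. by case/back_frontier => uL vW; rewrite (frontier_lt (ltnW vW) uL) vW. Qed.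

Definition step (D : seq nat) (v : nat) : op -> state -> seq state :=
  if v \in D then skip_step else cover_step.

Fixpoint reach D v (W : word) (s s' : state) : Prop :=
  if W is o :: W' then exists2 s1, s1 \in step D v o s & reach D v.+1 W' s1 s' else s = s'.

Lemma reach_cat D v W1 W2 s s' : reach D v (W1 ++ W2) s s' <->
  exists2 s1, reach D v W1 s s1 & reach D (v + size W1) W2 s1 s'.
Proof.
elim: W1 v s => [|o W1 IH] v s /=; first by rewrite addn0; split=> [|[_ <-]] //; exists s.
rewrite addnS -addSn; split.
  by case=> s1 s1o /IH[s2 r1 r2]; exists s2 => //; exists s1.
by case=> s2 [s1 s1o r1] r2; exists s1 => //; apply/IH; exists s2.
Qed.

Lemma reach_rcons D v W o s s' : reach D v (rcons W o) s s' <->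
  exists2 s1, reach D v W s s1 & s' \in step D (v + size W) o s1.
Proof.
rewrite -cats1; split=> [/reach_cat[s1 r1 [s2 r2 <-]]|[s1 r1 r2]]; first by exists s1.
by apply/reach_cat; exists s1 => //; exists s'.
Qed.

Section WellFormed.
Variable W : word.
Hypothesis wfW : well_formed W.
Notation e := (linked W).

Lemma reach_sound D t s : t <= size W -> reach D 0 (take t W) (Some [::]) s -> confs e D t (frontier W t) s.
Proof.
elim: t s => [|t IH] s tW.
  by rewrite /frontier take0 => <- /=; exists (fun=> [::]); split.
rewrite take_op // frontierS //; case/reach_rcons => s1 /(IH _ (ltnW tW)) H1.
rewrite add0n size_takel ?(ltnW tW) //; have [fit ub _] := proj1 wfW t tW.
have fit' : let: (p, a, b) := op_at W t in p + a <= size (frontier W t) by move: fit; rewrite /fits; case: (op_at W t) => [[]].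
rewrite /step; case: (boolP (t \in D)) => tD; case: s1 H1 => [s1|] H1.
- by case: H1 => P H1; exact: (skip_sound (P := P)).
- rewrite /= inE => /eqP -> /=; case: H1 => c [c1 c2 c3]; exists c; split=> //.
  by rewrite undeletedS tD cats0.
- case: H1 => P H1; apply: (cover_sound (linked_sym W) (P := P)) => // u uB.
  by rewrite /linked; apply/orP; left.
- by [].
Qed.

Lemma reach_complete t s P : t <= size W -> conf e [::] t (frontier W t) s P ->
  reach [::] 0 (take t W) (Some [::]) (Some (norm s)).
Proof.
elim: t s P => [|t IH] s P tW H.
  by case: H => + _ _; rewrite /frontier take0 /=; case: s.
have [fit ub _] := proj1 wfW t tW.
rewrite take_op //; apply/reach_rcons; rewrite add0n size_takel ?(ltnW tW) //.
move: H; rewrite frontierS //; move: fit ub; rewrite /fits /back.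
case Eo: (op_at W t) => [[p a] b] fit ub H.
have eLB u : u < t -> e u t -> u \in take a (drop p (frontier W t)).
  move=> ut /orP[|/back_lt]; first by rewrite /back Eo.
  by move=> /andP[tu _]; move: (ltn_trans ut tu); rewrite ltnn.
have [s0 [P0 [H0 s0s]]] := cover_complete (linked_sym W) fit ub (frontier_lt (ltnW tW)) eLB H.
by exists (Some (norm s0)); [exact: (IH _ _ (ltnW tW) H0) | rewrite /step in_nil cover_norm].
Qed.

(** A hamiltonian cycle contains the last vertex and so closes exactly there; what precedes is a
    path, to which [reach_complete] applies. *)
Lemma reach_closed : 0 < size W -> closed_conf e [::] (size W) -> reach [::] 0 W (Some [::]) None.
Proof.
move=> W0; case En: (size W) W0 => [//|t] _ H.
have tW : t < size W by rewrite En.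
have [fit ub _] := proj1 wfW t tW.
rewrite -(take_size W) En take_op //; apply/reach_rcons; rewrite add0n size_takel ?(ltnW tW) //.
move: fit ub; rewrite /fits /back.
case Eo: (op_at W t) => [[p a] b] fit ub.
have eLB u : u < t -> e u t -> u \in take a (drop p (frontier W t)).
  move=> ut /orP[|/back_lt]; first by rewrite /back Eo.
  by move=> /andP[tu _]; move: (ltn_trans ut tu); rewrite ltnn.
have [s0 [P0 [H0 s0s]]] := closed_complete (linked_sym W) b fit ub eLB H.
by exists (Some (norm s0)); [exact: reach_complete (ltnW tW) H0 | rewrite /step in_nil cover_norm].
Qed.
End WellFormed.

(** * Checking words *)

(** Comparisons meant for evaluation: the conditional stops at the first difference, where a
    conjunction would evaluate both arguments. *)
Fixpoint same (s t : seq nat) : bool :=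
  match s, t with
  | [::], [::] => true
  | x :: s', y :: t' => if eqn x y then same s' t' else false
  | _, _ => false
  end.
Fixpoint lexle (s t : seq nat) : bool :=
  match s, t with
  | [::], _ => true
  | x :: s', y :: t' => if eqn x y then lexle s' t' else leq x y
  | _, _ => false
  end.
Definition same_state (s t : state) :=
  match s, t with None, None => true | Some s, Some t => same s t | _, _ => false end.
Definition state_le (s t : state) :=
  match s, t with None, _ => true | Some s, Some t => lexle s t | _, _ => false end.
Fixpoint squash (xs : seq state) : seq state :=
  if xs is x :: xs' then
    let r := squash xs' in if xs' is y :: _ then if same_state x y then r else x :: r else x :: r
  else [::].
Definition dedup xs := squash (sort state_le xs).
Definition mems (xs : seq state) s := has (same_state s) xs.
Definition next (f : state -> seq state) xs := dedup (flatten (map f xs)).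

Lemma sameP s t : same_state s t -> s = t.
Proof.
case: s t => [s|] [t|] //=; elim: s t => [|x s IH] [|y t] //=.
by case: eqnP => // -> /IH [->].
Qed.

Lemma mem_squash xs : squash xs =i xs.
Proof.
elim: xs => [|x xs IH] //= s.
case: xs IH => [|y xs] IH; first by rewrite !inE.
case: ifP => [/sameP ->|_]; last by rewrite inE IH [in RHS]inE.
by rewrite IH !inE; case: (s == y).
Qed.

Lemma mem_dedup xs : dedup xs =i xs.
Proof. by move=> s; rewrite mem_squash mem_sort. Qed.

Lemma mem_next f xs s : reflect (exists2 s0, s0 \in xs & s \in f s0) (s \in next f xs).
Proof.
rewrite mem_dedup; apply: (iffP flattenP) => [[? /mapP[s0 s0x ->] H]|[s0 s0x H]]; first by exists s0.
by exists (f s0) => //; apply: map_f.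
Qed.

Lemma memsP xs s : mems xs s -> s \in xs.
Proof. by case/hasP => t tx /sameP ->. Qed.

Lemma mems_None xs : None \in xs -> mems xs None.
Proof. by move=> H; apply/hasP; exists None. Qed.

(* [T] are states without deleted vertices, the i-th entry of [Ts] are states with the source of the
   i-th strand deleted, and [Wd] are states with both ends of an edge deleted. Running through [W],
   each edge deleted on the way has to reach one of the final states [V]; the last component of the
   result are the states of [Wd] that reach [V]. *)
Fixpoint segment (W : word) (T : seq state) (Ts : seq (seq state)) (Wd V : seq state) :
    option (seq state * seq (seq state) * seq state) :=
  if W is o :: W' then
    let: (p, a, b) := o in
    let fwd := next (cover_step o) in
    let del := next (skip_step o) T in
    let ends := map (fun X => flatten (map (skip_step o) X)) (take a (drop p Ts)) in
    let Ts1 := map fwd (take p Ts) ++ nseq b del ++ map fwd (drop (p + a) Ts) in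
    match segment W' (fwd T) Ts1 (dedup (flatten (map (cover_step o) Wd) ++ flatten ends)) V with
    | Some (T', Ts', V1) =>
        if all (has (mems V1)) ends
        then Some (T', Ts', filter (fun s => has (mems V1) (cover_step o s)) Wd) else None
    | None => None
    end
  else Some (T, Ts, filter (mems V) Wd).

Definition run (W : word) (N : seq state) := foldl (fun N o => next (cover_step o) N) N W.

Lemma segment_run W T Ts Wd V T' Ts' V' : segment W T Ts Wd V = Some (T', Ts', V') -> T' = run W T.
Proof.
elim: W T Ts Wd T' Ts' V' => [|[[p a] b] W IH] T Ts Wd T' Ts' V' /=; first by case.
case E: (segment _ _ _ _ _) => [[[T1 Ts1] V1]|] //; case: ifP => // _ [<- _ _].
exact: IH E.
Qed.

Lemma reach_run v W N s s' : s \in N -> reach [::] v W s s' -> s' \in run W N.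
Proof.
elim: W v N s => [|o W IH] v N s sN /=; first by move=> <-.
case=> s1; rewrite /step in_nil => s1o r1; apply: IH r1.
by apply/mem_next; exists s.
Qed.

Lemma reach_ext D D' v W s s' : (forall t, v <= t < v + size W -> (t \in D) = (t \in D')) ->
  reach D v W s s' -> reach D' v W s s'.
Proof.
elim: W v s => [|o W IH] v s //= HD [s1 s1o r1]; exists s1.
  by move: s1o; rewrite /step HD //; lia.
by apply: IH r1 => t tv; apply: HD; move: tv; lia.
Qed.

Lemma mem_zip_map (f : seq state -> seq state) (L : seq nat) Ts u X :
  (u, X) \in zip L (map f Ts) -> exists2 Y, (u, Y) \in zip L Ts & X = f Y.
Proof.
elim: L Ts => [|x L IH] [|Y Ts] //=; rewrite inE => /orP[/eqP[-> ->]|/IH[Z Zin ->]].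
  by exists Y; rewrite ?mem_head.
by exists Z; rewrite // inE Zin orbT.
Qed.

Lemma mem_zip_nseq b (v u : nat) (Y X : seq state) : (u, X) \in zip (nseq b v) (nseq b Y) -> u = v /\ X = Y.
Proof. by elim: b => [|b IH] //=; rewrite inE => /orP[/eqP[-> ->]|]. Qed.

Lemma zip_split p a (L : seq nat) (Ts : seq (seq state)) : size Ts = size L ->
  zip L Ts = zip (take p L) (take p Ts) ++ zip (take a (drop p L)) (take a (drop p Ts)) ++ zip (drop (p + a) L) (drop (p + a) Ts).
Proof.
move=> E; rewrite {1}(split3 p a L) {1}(split3 p a Ts) !zip_cat // ?size_take ?size_drop E //.
Qed.

Definition covers (Q : word) (T : seq state) (Ts : seq (seq state)) :=
  [/\ size Ts = size (strands 0 [::] Q), {in T, forall s, reach [::] 0 Q (Some [::]) s} &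
   forall u X, (u, X) \in zip (strands 0 [::] Q) Ts -> {in X, forall s, reach [:: u] 0 Q (Some [::]) s}].
Definition served (Q : word) (V : seq state) :=
  forall u w, w < size Q -> u \in back Q w -> exists2 s, s \in V & reach [:: u; w] 0 Q (Some [::]) s.

Fixpoint fine v L (W : word) :=
  if W is o :: W' then
    let: (p, a, b) := o in
    [&& p + a <= size L, uniq (take a (drop p L)), (v == 0) || (0 < a) & fine v.+1 (strand_step v L o) W']
  else true.

Lemma back_cat Q W w : w < size Q -> back (Q ++ W) w = back Q w.
Proof. by move=> lt; rewrite /back /op_at /frontier nth_cat lt takel_cat // ltnW. Qed.

Lemma back_last Q o : back (rcons Q o) (size Q) = absorbed (strands 0 [::] Q) o.
Proof.
rewrite /back /op_at /frontier nth_rcons ltnn eqxx -cats1 takel_cat //.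
by rewrite take_size.
Qed.

(** [T] and [Ts] are pushed forward, [V] is pulled back to [V0]. An edge with both ends in [Q]
    leaves a state of [V0], which has a successor among the useful states one vertex later; an edge
    completed at the new vertex has been tested against these useful states directly ([Hends]). *)
Lemma segment_sound W Q T Ts Wd V T' Ts' V0 : {in strands 0 [::] Q, forall u, u < size Q} ->
  fine (size Q) (strands 0 [::] Q) W -> covers Q T Ts ->
  segment W T Ts Wd V = Some (T', Ts', V0) ->
  covers (Q ++ W) T' Ts' /\ (served Q V0 -> served (Q ++ W) V).
Proof.
elim: W Q T Ts Wd T' Ts' V0 => [|o W IH] Q T Ts Wd T' Ts' V0 LQ.
  move=> _ H [<- <- <-]; rewrite cats0; split=> // Sv u w wQ /(Sv u w wQ) [s].
  by rewrite mem_filter => /andP[/memsP sV _] r; exists s.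
case Eo: o => [[p a] b]; move=> /= /and4P[fit _ _ fineW] [sT HT HTs].
case E: (segment _ _ _ _ _) => [[[T1 Ts1] V1]|] //; case: ifP => // /allP Hends [E1 E2 E3]; subst T1 Ts1 V0.
rewrite -Eo -cat_rcons; set L := strands 0 [::] Q in LQ fit fineW sT HT HTs *.
have EL : strands 0 [::] (rcons Q o) = take p L ++ nseq b (size Q) ++ drop (p + a) L.
  by rewrite -cats1 strands_cat /= add0n Eo.
have zs := zip_split p a sT.
have cov u s s1 : u < size Q -> reach [:: u] 0 Q (Some [::]) s -> s1 \in cover_step o s ->
    reach [:: u] 0 (rcons Q o) (Some [::]) s1.
  move=> uQ r1 s1o; apply/reach_rcons; exists s => //.
  by rewrite /step add0n inE gtn_eqF.
have ltL u X : (u, X) \in zip L Ts -> u < size Q.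
  move=> H; apply: LQ; have : u \in unzip1 (zip L Ts) by apply/mapP; exists (u, X).
  by rewrite unzip1_zip // sT.
have cov' (u : nat) X : (u, X) \in zip L Ts -> {in next (cover_step o) X, forall s, reach [:: u] 0 (rcons Q o) (Some [::]) s}.
  move=> H s /mem_next[s0 s0X s0s]; apply: cov s0s; [exact: ltL H | exact: HTs H _ s0X].
have [|||cv sv] := IH (rcons Q o) _ _ _ _ _ _ _ _ _ E.
- move=> u; rewrite EL size_rcons !mem_cat mem_nseq.
  case/or3P => [/mem_take/LQ|/andP[_ /eqP->]|/mem_drop/LQ] //; lia.
- by rewrite EL size_rcons.
- split.
  + by rewrite EL !size_cat !size_map !size_nseq !size_drop !size_take sT.
  + move=> s; rewrite -Eo => /mem_next[s0 /HT r0 s0s]; apply/reach_rcons; exists s0 => //.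
  + move=> u X; rewrite EL !zip_cat ?size_map ?size_nseq ?size_take ?sT // !mem_cat -Eo.
    case/or3P => [/mem_zip_map[Y H ->]|/mem_zip_nseq[-> ->]|/mem_zip_map[Y H ->]].
    * by apply: cov'; rewrite zs mem_cat H.
    * move=> s /mem_next[s0 /HT r0 s0s]; apply/reach_rcons; exists s0.
        by apply: reach_ext r0 => t /andP[_ tQ]; rewrite !inE ltn_eqF.
      by rewrite /step add0n mem_head.
    * by apply: cov'; rewrite zs !mem_cat H !orbT.
split=> // Sv; apply: sv => u w; rewrite size_rcons ltnS leq_eqVlt => /orP[/eqP->|wQ].
  rewrite back_last Eo /= -/L => uL.
  have [X uX] : exists X, (u, X) \in zip (take a (drop p L)) (take a (drop p Ts)).
    have sz : size (take a (drop p L)) <= size (take a (drop p Ts)) by rewrite !size_take !size_drop sT.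
    have : u \in unzip1 (zip (take a (drop p L)) (take a (drop p Ts))) by rewrite unzip1_zip.
    by case/mapP => [[u' X] H /= ->]; exists X.
  have uXL : (u, X) \in zip L Ts by rewrite zs !mem_cat uX orbT.
  have : has (mems V1) (flatten (map (skip_step o) X)).
    rewrite Eo; apply: Hends; apply: (map_f (fun X => flatten (map (skip_step (p, a, b)) X))).
    have : X \in unzip2 (zip (take a (drop p L)) (take a (drop p Ts))) by apply/mapP; exists (u, X).
    by rewrite unzip2_zip // !size_take !size_drop sT.
  case/hasP => s /flattenP[? /mapP[s0 s0X ->] s0s] /memsP sV; exists s => //.
  have Estep : step [:: u; size Q] (0 + size Q) = skip_step by rewrite /step add0n !inE eqxx orbT.
  apply/reach_rcons; exists s0; last by rewrite Estep -Eo.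
  apply: reach_ext (HTs _ _ uXL _ s0X) => t /andP[_ tQ].
  by rewrite !inE [t == size Q]ltn_eqF ?orbF.
rewrite -cats1 back_cat // => /[dup] ub /(Sv u w wQ) [s]; rewrite mem_filter => /andP[/hasP[s1 s1o /memsP s1V] _] r1.
exists s1 => //; rewrite cats1; apply/reach_rcons; exists s => //.
have uw := back_lt ub.
by rewrite /step add0n !inE !gtn_eqF //; move: uw; lia.
Qed.

Lemma fine_cat v L W1 W2 : fine v L (W1 ++ W2) = fine v L W1 && fine (v + size W1) (strands v L W1) W2.
Proof.
elim: W1 v L => [|[[p a] b] W1 IH] v L /=; first by rewrite addn0.
by rewrite IH addSnnS -!andbA.
Qed.

Lemma fine_well_formed W : fine 0 [::] W -> strands 0 [::] W = [::] -> well_formed W.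
Proof.
move=> fW EW; split; last by rewrite /frontier take_size.
move=> t tW; move: fW; rewrite -{1}(cat_take_drop t W) fine_cat (drop_nth (0, 0, 0)) //.
case/andP => _; rewrite /= add0n size_takel ?(ltnW tW) // -/(op_at W t) -/(frontier W t).
rewrite /back /fits; case Eo: (op_at W t) => [[p a] b] /and4P[f1 f2 f3 _]; split=> // t0.
have sz : size (take a (drop p (frontier W t))) = a by rewrite size_takel // size_drop; move: f1; clear; lia.
by rewrite /= -size_eq0 sz; move: f3 t0; clear; lia.
Qed.

(** * Checking a segment independently of its position *)

Fixpoint fine_run v L (W : word) : option (seq nat) :=
  if W is o :: W' then
    let: (p, a, b) := o in
    if [&& p + a <= size L, uniq (take a (drop p L)) & (v == 0) || (0 < a)]
    then fine_run v.+1 (strand_step v L o) W' else None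
  else Some L.

(** The segment is evaluated with placeholders for the sources of the incoming strands, and [g]
    sends the true sources to them. Distinct images have distinct preimages, so a successful
    evaluation is valid wherever the segment stands. The condition on [w] and [v] transfers the
    exemption of the first vertex from absorbing a strand. *)
Lemma fine_run_map W v w L g L' : {in L, forall u, u < v} -> (w == 0 -> v == 0) ->
  fine_run w (map g L) W = Some L' ->
  fine v L W /\ exists g', map g' (strands v L W) = L'.
Proof.
elim: W v w L g => [|[[p a] b] W IH] v w L g Lv wv /=; first by case=> <-; split=> //; exists g.
case: ifP => // /and3P[fit uq a0] H.
pose g' x := if x == v then w else g x.
have gg s : {subset s <= L} -> map g' s = map g s.
  by move=> sL; apply/eq_in_map => x /sL /Lv xv; rewrite /g' ltn_eqF.
have E : take p (map g L) ++ nseq b w ++ drop (p + a) (map g L) =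
   map g' (take p L ++ nseq b v ++ drop (p + a) L).
  by rewrite !map_cat map_nseq {2}/g' eqxx !gg ?map_take ?map_drop // => x; [exact: mem_drop|exact: mem_take].
rewrite E in H; have [||f1 f2] := IH v.+1 w.+1 _ _ _ _ H => //.
  move=> u; rewrite !mem_cat mem_nseq.
  by case/or3P => [/mem_take/Lv|/andP[_ /eqP->]|/mem_drop/Lv] //; lia.
split=> //; rewrite f1 andbT; rewrite size_map in fit; rewrite fit.
rewrite -map_drop -map_take in uq; rewrite (map_uniq uq).
by case/orP: a0 => [/wv ->|->]; rewrite ?orbT.
Qed.

Lemma map_index_iota (s : seq nat) : uniq s -> map (index^~ s) s = iota 0 (size s).
Proof.
move=> us; apply: (@eq_from_nth _ 0); first by rewrite size_map size_iota.
by move=> i; rewrite size_map => si; rewrite (nth_map 0) // nth_iota // index_uniq.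
Qed.

Definition distinct8 (x : option (seq nat)) := if x is Some s then uniq s && (size s == 8) else false.
Definition ends_empty (x : option (seq nat)) := if x is Some s then s == [::] else false.

Lemma fine_run_distinct W v w L k : {in L, forall u, u < v} -> (w == 0 -> v == 0) ->
  uniq L -> size L = k -> distinct8 (fine_run w (iota 0 k) W) ->
  [/\ fine v L W, uniq (strands v L W) & size (strands v L W) = 8].
Proof.
move=> Lv wv uL <-; rewrite -(map_index_iota uL).
case E: (fine_run _ _ _) => [L'|] //= /andP[uL' /eqP sL'].
have [f1 [g' Eg]] := fine_run_map Lv wv E.
by rewrite -Eg in uL' sL'; split=> //; [exact: map_uniq uL' | rewrite -sL' size_map].
Qed.

Lemma fine_run_empty W v w L k : {in L, forall u, u < v} -> (w == 0 -> v == 0) ->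
  uniq L -> size L = k -> ends_empty (fine_run w (iota 0 k) W) ->
  fine v L W /\ strands v L W = [::].
Proof.
move=> Lv wv uL <-; rewrite -(map_index_iota uL).
case E: (fine_run _ _ _) => [L'|] //= /eqP EL'.
have [f1 [g' Eg]] := fine_run_map Lv wv E.
by split=> //; apply: size0nil; rewrite -(size_map g') Eg EL'.
Qed.

(** * Induction along the chain of loops *)

Definition subs xs ys := all (mems ys) xs.
Definition subs2 (Xs Ys : seq (seq state)) := (size Xs == size Ys) && all (fun p => subs p.1 p.2) (zip Xs Ys).
Definition start : seq state := [:: Some [::]].

Lemma subsP xs ys : subs xs ys -> {subset xs <= ys}.
Proof. by move=> /allP H x /H /memsP. Qed.

Lemma zip_subs2 (L : seq nat) Xs Ys u X : subs2 Xs Ys -> (u, X) \in zip L Xs ->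
  exists2 Y, (u, Y) \in zip L Ys & {subset X <= Y}.
Proof.
elim: L Xs Ys => [|x L IH] [|X0 Xs] [|Y0 Ys] //; rewrite /subs2 /= eqSS => /and3P[sz h1 h2].
rewrite inE => /orP[/eqP[-> ->]|H]; first by exists Y0; [rewrite mem_head | exact: subsP].
have [|Y uY XY] := IH Xs Ys _ H; first by rewrite /subs2 sz.
by exists Y; rewrite // inE uY orbT.
Qed.

Lemma covers_sub Q T T' Ts Ts' : subs T T' -> subs2 Ts Ts' -> covers Q T' Ts' -> covers Q T Ts.
Proof.
move=> /subsP TT' TT2 [H1 H2 H3]; split.
- by rewrite -H1; case/andP: TT2 => /eqP.
- by move=> s /TT'; exact: H2.
- by move=> u X /(zip_subs2 TT2)[Y uY XY] s /XY; exact: H3 uY _.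
Qed.

Section Chain.
(* [T] and [Ts] are states reachable at the cut with no deletion and with the source of a strand
   deleted, [V] are states sufficing after both ends of an edge are deleted, and [N] contains all
   states reachable without deletion. *)
Variables (T : seq state) (Ts : seq (seq state)) (V N : seq state).

(** The inclusions point in opposite directions: [T] and [Ts] must be contained in what is actually
    reached, while [N] must contain everything reached. *)
Definition check_left (L : word) :=
  distinct8 (fine_run 0 [::] L) &&
  (if segment L start [::] [::] V is Some (T', Ts', _) then [&& subs T T', subs2 Ts Ts' & subs T' N] else false).
Definition check_loop (F : word) :=
  [&& distinct8 (fine_run 8 (iota 0 8) F), subs (run F N) N &
  if segment F T Ts V V is Some (T', Ts', V') then [&& subs T T', subs2 Ts Ts' & subs V V'] else false].
Definition check_right (B : word) :=
  [&& ends_empty (fine_run 8 (iota 0 8) B), ~~ mems (run B N) None &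
  if segment B T Ts V [:: None] is Some (_, _, V') then subs V V' else false].

(** Nothing here depends on the length of [Q], so one evaluation of the loop carries the property
    through any number of copies. The eight sources have to be distinct for the placeholders 0, ...,
    7 to stand for them. *)
Definition stage (Q : word) :=
  [/\ fine 0 [::] Q /\ 0 < size Q, uniq (strands 0 [::] Q) /\ size (strands 0 [::] Q) = 8, covers Q T Ts, served Q V &
   forall s, reach [::] 0 Q (Some [::]) s -> s \in N].

Lemma strands_lt Q : {in strands 0 [::] Q, forall u, u < size Q}.
Proof. by move=> u uQ; apply: (@frontier_lt Q (size Q)); rewrite // /frontier take_size. Qed.

Lemma stage_left L : 0 < size L -> check_left L -> stage L.
Proof.
move=> L0 /andP[HL]; case E: (segment _ _ _ _ _) => [[[T' Ts'] V']|] // /and3P[s1 s2 s3].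
have [|f1 f2 f3] := @fine_run_distinct L 0 0 [::] 0 _ (fun h => h) isT erefl HL; first by [].
have c0 : covers [::] start [::].
  by split=> // s; rewrite inE => /eqP ->.
have [|c1 sv] := segment_sound (Q := [::]) _ f1 c0 E; first by [].
have r1 := segment_run E.
split=> //; first exact: covers_sub s1 s2 c1.
  (* The empty word has no edge, so there is nothing to serve before the cap. *)
  by apply: sv => u w; rewrite ltn0.
by move=> s r; apply: (subsP s3); rewrite r1; apply: reach_run r; rewrite mem_head.
Qed.

Lemma stage_loop Q F : check_loop F -> stage Q -> stage (Q ++ F).
Proof.
case/and3P => HF HN; case E: (segment _ _ _ _ _) => [[[T' Ts'] V']|] // /and3P[s1 s2 s3].
case=> [[q1 q0] [q2 q3] q4 q5 q6].
have [|f1 f2 f3] := fine_run_distinct (@strands_lt Q) _ q2 q3 HF; first by [].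
have [c1 sv] := segment_sound (@strands_lt Q) f1 q4 E.
split.
- by rewrite fine_cat q1 add0n f1 size_cat addn_gt0 q0.
- by rewrite strands_cat add0n.
- exact: covers_sub s1 s2 c1.
- by apply: sv => u w wQ uw; have [s sV r] := q5 u w wQ uw; exists s => //; exact: subsP sV.
- move=> s /reach_cat[s0 r0 r1]; apply: (subsP HN).
  by rewrite add0n in r1; apply: reach_run r1; exact: q6.
Qed.

Lemma stage_right Q B : check_right B -> stage Q ->
  [/\ well_formed (Q ++ B), served (Q ++ B) [:: None] & ~ reach [::] 0 (Q ++ B) (Some [::]) None].
Proof.
case/and3P => HF HN; case E: (segment _ _ _ _ _) => [[[T' Ts'] V']|] // s3.
case=> [[q1 q0] [q2 q3] q4 q5 q6].
have [|f1 f2] := fine_run_empty (@strands_lt Q) _ q2 q3 HF; first by [].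
have [c1 sv] := segment_sound (@strands_lt Q) f1 q4 E.
split.
- apply: fine_well_formed; first by rewrite fine_cat q1 add0n f1.
  by rewrite strands_cat add0n.
- by apply: sv => u w wQ uw; have [s sV r] := q5 u w wQ uw; exists s => //; exact: subsP sV.
- case/reach_cat => s0 r0 r1; case/negP: HN; apply: mems_None.
  by rewrite add0n in r1; apply: reach_run r1; exact: q6.
Qed.

Lemma stage_iter m Q F : check_loop F -> stage Q -> stage (Q ++ flatten (nseq m F)).
Proof.
move=> HF; elim: m Q => [|m IH] Q HQ; first by rewrite cats0.
by rewrite /= catA; apply: IH; exact: stage_loop.
Qed.

End Chain.

(** * The caps and the loop *)

(** The sizes 37, 75 and 113 grow by 38, so they represent the residues 1, 0 and 2 modulo 3. The two
    longer caps agree in their last 37 operations. *)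
Definition cap37 : word :=
  [:: (0, 0, 4); (1, 1, 3); (3, 2, 2); (5, 1, 3); (4, 1, 2); (5, 2, 1); (5, 1, 2); (6, 1, 3); (8, 2,
   1); (4, 1, 2); (5, 2, 1); (5, 1, 2); (6, 2, 1); (4, 1, 2); (5, 2, 1); (3, 2, 2); (5, 1, 2); (6,
   2, 1); (4, 2, 1); (0, 1, 2); (1, 1, 2); (2, 2, 1); (5, 1, 2); (6, 2, 1); (6, 2, 1); (6, 1, 3);
   (8, 2, 1); (5, 2, 1); (4, 2, 1); (3, 2, 2); (7, 1, 2); (6, 2, 1); (4, 2, 2); (5, 2, 1); (0, 1,
   2); (1, 1, 2); (2, 2, 1)].
Definition cap75 : word :=
  [:: (0, 0, 4); (2, 1, 3); (1, 2, 2); (2, 1, 2); (3, 1, 2); (4, 2, 1); (2, 1, 2); (3, 1, 2); (4, 2,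
   1); (4, 1, 2); (5, 2, 1); (3, 1, 2); (4, 2, 1); (4, 1, 2); (5, 2, 1); (5, 2, 2); (2, 1, 2); (3,
   2, 2); (4, 2, 2); (5, 2, 1); (1, 2, 2); (2, 1, 2); (3, 2, 1); (3, 1, 2); (4, 2, 1); (4, 1, 2);
   (5, 2, 1); (5, 1, 2); (6, 2, 1); (6, 2, 1); (3, 1, 2); (2, 2, 1); (3, 2, 2); (4, 2, 1); (4, 2,
   1); (1, 1, 2); (2, 2, 1); (2, 2, 1); (2, 1, 3); (3, 1, 2); (3, 1, 2); (5, 1, 2); (4, 1, 2); (5,
   2, 1); (7, 1, 2); (6, 2, 2); (5, 1, 2); (6, 2, 1); (4, 1, 2); (5, 2, 1); (5, 1, 2); (6, 2, 1);
   (6, 1, 2); (7, 2, 1); (5, 1, 2); (6, 2, 1); (4, 2, 2); (3, 2, 2); (2, 2, 2); (1, 2, 1); (5, 1,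
   2); (4, 2, 1); (5, 2, 2); (6, 2, 1); (2, 2, 2); (3, 2, 2); (4, 2, 2); (5, 1, 2); (6, 2, 1); (6,
   2, 1); (1, 1, 2); (2, 2, 1); (0, 1, 2); (1, 1, 2); (2, 2, 1)].
Definition cap113 : word :=
  [:: (0, 0, 3); (1, 1, 3); (2, 1, 2); (2, 1, 2); (2, 1, 2); (1, 2, 1); (4, 1, 2); (4, 1, 2); (3, 2,
   1); (3, 1, 2); (2, 2, 2); (5, 1, 2); (4, 2, 1); (3, 1, 2); (4, 2, 1); (4, 1, 2); (5, 2, 1); (5,
   2, 1); (5, 2, 2); (4, 2, 2); (5, 2, 2); (6, 2, 1); (3, 2, 2); (3, 1, 2); (2, 2, 1); (1, 2, 2);
   (0, 2, 1); (4, 1, 2); (3, 2, 1); (1, 1, 2); (2, 2, 1); (2, 2, 1); (2, 1, 2); (1, 2, 1); (0, 2,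
   1); (2, 1, 2); (3, 1, 2); (4, 2, 1); (4, 1, 2); (3, 1, 2); (4, 2, 1); (2, 1, 2); (3, 2, 2); (3,
   1, 2); (3, 1, 2); (2, 2, 1); (1, 1, 2); (2, 2, 2); (4, 1, 2); (3, 2, 1); (5, 1, 2); (4, 2, 1);
   (4, 1, 2); (3, 2, 1); (5, 1, 2); (4, 2, 1); (5, 2, 2); (6, 2, 2); (5, 2, 2); (4, 2, 1); (3, 2,
   2); (2, 2, 1); (2, 1, 2); (1, 2, 1); (2, 1, 2); (3, 2, 1); (3, 2, 2); (2, 1, 2); (3, 2, 1); (1,
   2, 1); (0, 1, 2); (1, 2, 1); (1, 2, 1); (3, 1, 2); (2, 2, 1); (1, 2, 1); (2, 1, 3); (3, 1, 2);
   (3, 1, 2); (5, 1, 2); (4, 1, 2); (5, 2, 1); (7, 1, 2); (6, 2, 2); (5, 1, 2); (6, 2, 1); (4, 1,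
   2); (5, 2, 1); (5, 1, 2); (6, 2, 1); (6, 1, 2); (7, 2, 1); (5, 1, 2); (6, 2, 1); (4, 2, 2); (3,
   2, 2); (2, 2, 2); (1, 2, 1); (5, 1, 2); (4, 2, 1); (5, 2, 2); (6, 2, 1); (2, 2, 2); (3, 2, 2);
   (4, 2, 2); (5, 1, 2); (6, 2, 1); (6, 2, 1); (1, 1, 2); (2, 2, 1); (0, 1, 2); (1, 1, 2); (2, 2,
   1)].
Definition loop15 : word :=
  [:: (3, 1, 2); (2, 2, 1); (2, 1, 2); (4, 2, 1); (3, 2, 2); (7, 1, 2); (6, 2, 1); (4, 2, 2); (5, 2,
   1); (1, 2, 2); (1, 1, 2); (0, 2, 1); (0, 1, 2); (1, 1, 2); (2, 2, 1)].
Definition tail15 : word :=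
  [:: (3, 1, 2); (2, 2, 1); (3, 2, 1); (2, 1, 2); (1, 2, 1); (4, 1, 2); (2, 3, 1); (2, 1, 2); (1, 2,
   1); (0, 2, 1); (3, 1, 2); (2, 2, 1); (1, 2, 1); (0, 2, 1); (0, 3, 0)].
Definition tail18 : word :=
  [:: (3, 1, 2); (4, 2, 1); (2, 2, 2); (5, 1, 2); (4, 2, 1); (3, 2, 1); (2, 1, 2); (1, 2, 1); (6, 1,
   2); (5, 2, 1); (4, 2, 2); (3, 2, 1); (2, 2, 1); (3, 1, 2); (2, 2, 1); (1, 2, 1); (2, 2, 1); (0,
   3, 0)].
Definition tail21 : word :=
  [:: (3, 1, 2); (2, 2, 1); (3, 2, 1); (4, 1, 2); (3, 2, 2); (2, 2, 2); (1, 2, 1); (1, 1, 2); (0, 2,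
   1); (2, 1, 2); (1, 2, 1); (1, 1, 2); (0, 2, 1); (3, 1, 2); (2, 2, 1); (1, 2, 1); (4, 1, 2); (3,
   2, 1); (2, 2, 1); (1, 2, 1); (0, 4, 0)].
Definition tail24 : word :=
  [:: (3, 1, 2); (2, 2, 1); (2, 1, 2); (4, 2, 1); (3, 2, 2); (7, 1, 2); (6, 2, 1); (4, 2, 2); (5, 2,
   1); (1, 2, 2); (3, 1, 2); (2, 2, 1); (4, 1, 2); (3, 2, 1); (5, 1, 2); (4, 2, 1); (4, 1, 2); (3,
   2, 1); (2, 2, 1); (4, 2, 2); (3, 2, 1); (2, 2, 1); (1, 2, 1); (0, 3, 0)].
Definition tail27 : word :=
  [:: (3, 1, 2); (2, 2, 1); (3, 2, 1); (2, 1, 2); (1, 2, 1); (6, 1, 2); (5, 2, 1); (1, 1, 2); (0, 2,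
   1); (5, 1, 2); (7, 1, 2); (6, 2, 1); (4, 2, 2); (6, 1, 2); (5, 2, 1); (7, 1, 2); (6, 2, 1); (6,
   1, 2); (5, 2, 1); (5, 1, 2); (2, 4, 1); (1, 2, 1); (3, 1, 2); (2, 2, 1); (1, 2, 1); (2, 2, 1);
   (0, 3, 0)].

(** A selection of reachable states, small but sufficient: each cap reaches them, the loop reaches
    them again, and for every edge deleted further right they offer a continuation. *)
Definition intact : seq state :=
  [:: Some [:: 0; 0; 0; 0; 1; 2; 2; 1]; Some [:: 0; 0; 0; 1; 1; 2; 0; 2]; Some [:: 0; 0; 1; 0; 0; 1;
   2; 2]; Some [:: 0; 1; 1; 0; 2; 2; 3; 3]; Some [:: 1; 0; 1; 2; 3; 0; 3; 2]; Some [:: 1; 0; 1; 2;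
   3; 3; 2; 0]; Some [:: 1; 1; 0; 0; 0; 2; 0; 2]; Some [:: 1; 1; 0; 0; 2; 0; 0; 2]; Some [:: 1; 1;
   0; 0; 2; 2; 3; 3]; Some [:: 1; 1; 0; 2; 0; 2; 3; 3]; Some [:: 1; 1; 0; 2; 0; 3; 3; 2]; Some [::
   1; 1; 0; 2; 3; 0; 3; 2]; Some [:: 1; 1; 2; 2; 3; 3; 0; 0]; Some [:: 1; 2; 2; 0; 0; 0; 0; 1]; Some
   [:: 1; 2; 2; 0; 1; 3; 3; 0]].
(** One state for each strand suffices; the i-th has label 0 on the i-th strand, whose source is
    missing. *)
Definition lacking : seq (seq state) :=
  [:: [:: Some [:: 0; 1; 1; 2; 3; 0; 3; 2]]; [:: Some [:: 1; 0; 2; 2; 3; 3; 1; 0]]; [:: Some [:: 0;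
   1; 0; 1; 2; 3; 3; 2]]; [:: Some [:: 1; 1; 2; 0; 3; 3; 2; 0]]; [:: Some [:: 1; 1; 0; 2; 0; 3; 3;
   2]]; [:: Some [:: 1; 2; 0; 2; 1; 0; 3; 3]]; [:: Some [:: 0; 1; 2; 2; 0; 0; 0; 1]]; [:: Some [::
   0; 1; 2; 2; 3; 3; 1; 0]]].
Definition lacking2 : seq state :=
  [:: Some [:: 0; 0; 0; 0; 1; 1; 0; 0]; Some [:: 0; 0; 1; 1; 2; 0; 0; 2]; Some [:: 0; 1; 0; 0; 0; 0;
   1; 0]; Some [:: 0; 1; 0; 2; 2; 0; 1; 0]; Some [:: 0; 1; 1; 0; 2; 0; 2; 0]; Some [:: 1; 0; 0; 0;
   0; 0; 0; 1]; Some [:: 1; 0; 1; 2; 0; 0; 2; 0]; Some [:: 1; 1; 0; 0; 0; 0; 2; 2]; Some [:: 1; 2;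
   2; 0; 1; 0; 3; 3]].

Definition loop30 := loop15 ++ loop15.
Definition tails := [:: tail15; tail18; tail21; tail24; tail27].
(** Found by iteration: the states reachable after one cap and three copies of [loop15] already
    include those left by every cap and are mapped into themselves by [loop30], as the checks below
    confirm. *)
Definition possible := Eval vm_compute in run (cap37 ++ loop15 ++ loop30) start.

Lemma caps_checked : all (check_left intact lacking lacking2 possible) [:: cap37; cap75; cap113].
Proof. by vm_compute. Qed.

Lemma loop_checked : check_loop intact lacking lacking2 possible loop30.
Proof. by vm_compute. Qed.

Lemma tails_checked :
  all (check_right intact lacking lacking2 possible) (tails ++ map (cat loop15) tails).
Proof. by vm_compute. Qed.

Definition chain_word (W : word) :=
  [/\ well_formed W, served W [:: None] & ~ reach [::] 0 W (Some [::]) None].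

Lemma chain_left n : 134 <= n ->
  exists L, [/\ L \in [:: cap37; cap75; cap113], 15 <= n - size L & 3 %| n - size L].
Proof.
(* The cap is chosen by the residue of [n]; the remainder is then a multiple of 3 and at least 15,
   the size of the smallest right cap. *)
move=> hn; have : n %% 3 < 3 by rewrite ltn_mod.
case E: (n %% 3) => [|[|[|]]] // _; [exists cap75 | exists cap37 | exists cap113];
  rewrite !inE eqxx ?orbT; (split; [by []| |]).
- by rewrite (_ : size cap75 = 75) //; lia.
- by rewrite (_ : size cap75 = 75) //; lia.
- by rewrite (_ : size cap37 = 37) //; lia.
- by rewrite (_ : size cap37 = 37) //; lia.
- by rewrite (_ : size cap113 = 113) //; lia.
- by rewrite (_ : size cap113 = 113) //; lia.
Qed.

Lemma chain_right r : 15 <= r -> 3 %| r ->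
  exists B m, B \in tails ++ map (cat loop15) tails /\ r = 30 * m + size B.
Proof.
(* [r] is written as 15 + 3k + 30m with k < 10: the ten right caps advance by 3 and together span
   one loop. *)
move=> r15 r3; set k := (r - 15) %/ 3 %% 10; have k10 : k < 10 by rewrite ltn_mod.
set all_tails := tails ++ _.
have sz : map size all_tails = [seq 15 + 3 * i | i <- iota 0 10] by [].
have sB : size (nth [::] all_tails k) = 15 + 3 * k.
  transitivity (nth 0 (map size all_tails) k); first by rewrite (nth_map [::]).
  by rewrite sz (nth_map 0) ?size_iota // nth_iota.
exists (nth [::] all_tails k), ((r - 15) %/ 30); split; first exact: mem_nth.
by rewrite sB /k; move: r15 r3; clear; lia.
Qed.

Lemma chain_exists n : 134 <= n -> exists W, size W = n /\ chain_word W.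
Proof.
move=> hn; have [L [Lc L15 L3]] := chain_left hn.
have [B [m [Bc Er]]] := chain_right L15 L3.
exists ((L ++ flatten (nseq m loop30)) ++ B); split.
  have sF : size (flatten (nseq m loop30)) = 30 * m.
    have gen (F : word) : size (flatten (nseq m F)) = size F * m.
      by elim: (m) => [|m' IH] /=; rewrite ?muln0 // size_cat IH mulnS.
    exact: gen.
  by rewrite !size_cat sF -addnA -Er subnKC // ltnW // -subn_gt0 (leq_ltn_trans _ L15).
apply: (stage_right (allP tails_checked B Bc)); apply: (stage_iter m loop_checked).
apply: stage_left (allP caps_checked L Lc).
by move: Lc; rewrite !inE => /or3P[] /eqP ->.
Qed.

(** * The planar drawing of a word *)

(** Contraction of the strands in [B] to the vertex [c] at which they meet. *)
Definition collapse (T : eqType) (B : seq T) (c x : T) := if x \in B then c else x.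

(** [B] may be empty, since the first vertex absorbs nothing and the last one emits nothing; then
    [c] is inserted rather than substituted, and the formula covers this case too. *)
Lemma index_collapse (T : eqType) (A1 B A2 : seq T) c x : uniq (A1 ++ B ++ A2) ->
  c \notin A1 ++ A2 -> x \in A1 ++ B ++ A2 ->
  index (collapse B c x) (A1 ++ c :: A2) =
    let i := index x (A1 ++ B ++ A2) in
    if i < size A1 then i else if i < size A1 + size B then size A1 else i.+1 - size B.
Proof.
rewrite mem_cat negb_or => uE /andP[c1 c2] xE /=.
have uB y : y \in B -> (y \notin A1) * (y \notin A2).
  move=> yB; move: uE; rewrite !cat_uniq => /and3P[_ h1 /and3P[_ h2 _]]; split.
    by apply: contra h1 => y1; apply/hasP; exists y; rewrite // mem_cat yB.
  by apply: contra h2 => y2; apply/hasP; exists y.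
rewrite /collapse !index_cat; case: (boolP (x \in B)) => xB.
  rewrite (negbTE c1) /= eqxx addn0 (negbTE (uB x xB).1) ltnNge leq_addr /=.
  by rewrite ltn_add2l index_mem xB.
case: (boolP (x \in A1)) => x1; first by rewrite index_mem x1.
have x2 : x \in A2 by move: xE; rewrite !mem_cat (negbTE x1) (negbTE xB).
rewrite /=; case: eqVneq => [cx|_]; first by rewrite cx x2 in c2.
rewrite ltnNge leq_addr /= ltn_add2l ltnNge leq_addr /=.
by move: (index x A2) (size A1) (size B) => i n m; clear; lia.
Qed.

Lemma index_collapse_mono (T : eqType) (A1 B A2 : seq T) c x y : uniq (A1 ++ B ++ A2) ->
  c \notin A1 ++ A2 -> x \in A1 ++ B ++ A2 -> y \in A1 ++ B ++ A2 ->
  index x (A1 ++ B ++ A2) < index y (A1 ++ B ++ A2) ->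
  index (collapse B c x) (A1 ++ c :: A2) <= index (collapse B c y) (A1 ++ c :: A2).
Proof.
move=> uE cN xE yE; rewrite !index_collapse //=.
move: (index x _) (index y _) (size A1) (size B) => i j n m; clear => ij.
by case: ltnP => h1; case: ltnP => h2 //; try case: ltnP => h3; try case: ltnP => h4; lia.
Qed.

Lemma index_inj_in (T : eqType) (s : seq T) x y : x \in s -> index x s = index y s -> x = y.
Proof.
move=> xs E; have ys : y \in s by rewrite -index_mem -E index_mem.
by rewrite -(nth_index x xs) E nth_index.
Qed.

Notation edge := (nat * nat)%type.

(* The strands as pairs (source, target); unlike the sources alone these are distinct. *)
Fixpoint slots t L (W : word) : seq edge :=
  if W is o :: W' then
    let: (p, a, b) := o in
    let R := slots t.+1 (strand_step t L o) W' in
    take p R ++ [seq (u, t) | u <- take a (drop p L)] ++ drop (p + b) R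
  else [::].

(** * Edges as strands and their vertical order *)

Section Slots.
Variable W : word.
Hypothesis wfW : well_formed W.

Definition slot t := slots t (frontier W t) (drop t W).
Definition below t := take (op_at W t).1.1 (slot t.+1).
Definition above t := drop ((op_at W t).1.1 + (op_at W t).2) (slot t.+1).
Definition emitted t := take (op_at W t).2 (drop (op_at W t).1.1 (slot t.+1)).
Definition taken t := [seq (u, t) | u <- back W t].

Lemma slot_in t : t < size W -> slot t = below t ++ taken t ++ above t.
Proof.
move=> tW; rewrite /slot (drop_nth (0, 0, 0)) // /below /above /taken /back /slot frontierS //.
by rewrite -/(op_at W t); case: (op_at W t) => [[p a] b].
Qed.

Lemma slot_out t : slot t.+1 = below t ++ emitted t ++ above t.
Proof. exact: split3. Qed.

Lemma slot_end : slot (size W) = [::].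
Proof. by rewrite /slot drop_size. Qed.

(** The targets become known from the right end, where no strand is left, so properties of [slot]
    are proved downwards from there. *)
Lemma slot_ind (P : nat -> Prop) : P (size W) -> (forall t, t < size W -> P t.+1 -> P t) ->
  forall t, t <= size W -> P t.
Proof.
move=> Pn PS t; move E: (size W - t) => d; elim: d t E => [|d IH] t E tW.
  by have -> : t = size W by lia.
by apply: PS; [lia | apply: IH; lia].
Qed.

Lemma slot_fst t : t <= size W -> map fst (slot t) = frontier W t.
Proof.
move: t; apply: slot_ind => [|t tW E]; first by rewrite slot_end (proj2 wfW).
rewrite slot_in // !map_cat -map_comp map_id_in // /below /above map_take map_drop E frontierS //.
have [fit _ _] := proj1 wfW t tW; move: fit; rewrite /fits /back.
case: (op_at W t) => [[p a] b] /= fit.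
have sp : size (take p (frontier W t)) = p by rewrite size_takel //; move: fit; lia.
rewrite take_size_cat //.
have -> : drop (p + b) (take p (frontier W t) ++ nseq b t ++ drop (p + a) (frontier W t)) = drop (p + a) (frontier W t).
  by rewrite catA drop_size_cat // size_cat size_nseq sp.
by rewrite -split3.
Qed.

Lemma slot_snd t : t <= size W -> {in slot t, forall x, t <= x.2}.
Proof.
move: t; apply: slot_ind => [|t tW IH] x; first by rewrite slot_end.
rewrite slot_in // !mem_cat => /or3P[/mem_take/IH|/mapP[u _ ->]|/mem_drop/IH] //; lia.
Qed.

Lemma slot_lt t : t <= size W -> {in slot t, forall x, x.1 < t}.
Proof. by move=> tW x xs; apply: (frontier_lt tW); rewrite -slot_fst // map_f. Qed.

Lemma belowP t x : t < size W -> x \in below t ++ above t -> x.1 < t < x.2.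
Proof.
move=> tW xb; apply/andP; split.
  apply: (slot_lt (ltnW tW)); rewrite slot_in // !mem_cat.
  by move: xb; rewrite mem_cat => /orP[]->; rewrite ?orbT.
apply: (slot_snd tW); rewrite slot_out !mem_cat.
by move: xb; rewrite mem_cat => /orP[]->; rewrite ?orbT.
Qed.

Lemma emitted_fst t x : t < size W -> x \in emitted t -> x.1 = t.
Proof.
move=> tW xe; have : x.1 \in map fst (emitted t) by rewrite map_f.
rewrite /emitted map_take map_drop slot_fst // frontierS //.
have [fit _ _] := proj1 wfW t tW; move: fit; rewrite /fits /back.
case: (op_at W t) => [[p a] b] /= fit.
have sp : size (take p (frontier W t)) = p by rewrite size_takel //; move: fit; lia.
rewrite -{1}sp drop_size_cat // -{1}(size_nseq b t) take_size_cat // mem_nseq.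
by case/andP => _ /eqP.
Qed.

Lemma emittedE t x : t < size W -> x \in slot t.+1 -> (x \in emitted t) = (x.1 == t).
Proof.
move=> tW; rewrite slot_out !mem_cat; case: (boolP (x \in emitted t)) => [/(emitted_fst tW)->|_ /= H].
  by rewrite eqxx.
by have := belowP (x := x) tW; rewrite mem_cat H => /(_ isT) /andP[lt _]; rewrite ltn_eqF.
Qed.

Lemma takenE t x : t < size W -> x \in slot t -> (x \in taken t) = (x.2 == t).
Proof.
move=> tW; rewrite slot_in // !mem_cat; case: (boolP (x \in taken t)) => [/mapP[u _ ->]|_ /= H].
  by rewrite eqxx.
by have := belowP (x := x) tW; rewrite mem_cat H => /(_ isT) /andP[_ lt]; rewrite gtn_eqF.
Qed.

Lemma slot_uniq t : t <= size W -> uniq (slot t).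
Proof.
move: t; apply: slot_ind => [|t tW IH]; first by rewrite slot_end.
rewrite slot_in // uniq_catCA cat_uniq; apply/and3P; split.
- by rewrite map_inj_uniq; [have [] := proj1 wfW t tW | move=> u u' []].
- apply/hasPn => x /(belowP tW) /andP[_ lt]; apply/negP => /mapP[u _ E].
  by move: lt; rewrite E /= ltnn.
- by move: IH; rewrite slot_out uniq_catCA cat_uniq => /and3P[].
Qed.

Lemma slot_mem u v t : u \in back W v -> u < t <= v -> (u, v) \in slot t.
Proof.
move=> uv /andP[ut tv]; have /andP[_ vW] := back_lt uv.
suff key : forall t', t' <= size W -> u < t' -> t' <= v -> (u, v) \in slot t'.
  by apply: key => //; apply: leq_trans tv (ltnW vW).
apply: slot_ind => [|t' tW IH] ut' tv'; first by move: tv'; rewrite leqNgt vW.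
rewrite slot_in // !mem_cat; case: (eqVneq t' v) => [E|tv''].
  have -> : (u, v) \in taken t' by rewrite /taken E; apply/mapP; exists u.
  by rewrite orbT.
have lt : t' < v by rewrite ltn_neqAle tv''.
have := IH (ltnW ut') lt; rewrite slot_out !mem_cat.
case/or3P => [->|/(emitted_fst tW) /= E|->]; rewrite ?orbT //.
by rewrite E ltnn in ut'.
Qed.

(* The strands crossing the abscissa [t], with [(t, t)] standing for the vertex [t]. *)
Definition column t := below t ++ (t, t) :: above t.
Definition height (x : edge) t := index (if (x.1 == t) || (x.2 == t) then (t, t) else x) (column t).
Definition level t := index (t, t) (column t).

Lemma diag_notin t : t < size W -> (t, t) \notin below t ++ above t.
Proof. by move=> tW; apply/negP => /(belowP tW) /=; rewrite ltnn. Qed.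

Lemma height_start x : height x x.1 = level x.1.
Proof. by rewrite /height eqxx. Qed.

Lemma height_end x : height x x.2 = level x.2.
Proof. by rewrite /height eqxx orbT. Qed.

(** The column at [t] arises from [slot t.+1] by contracting the emitted block and from [slot t] by
    contracting the absorbed one; the passing strands are the same. This pair of descriptions
    carries the order of the strands across a vertex. *)
Lemma height_out t x : t < size W -> x \in slot t.+1 -> height x t = index (collapse (emitted t) (t, t) x) (column t).
Proof.
move=> tW xs; rewrite /height /collapse emittedE //; case: eqVneq => //= _.
by rewrite gtn_eqF // (slot_snd tW).
Qed.

Lemma height_in t x : t < size W -> x \in slot t -> height x t = index (collapse (taken t) (t, t) x) (column t).
Proof.
move=> tW xs; rewrite /height /collapse takenE //.
by rewrite ltn_eqF ?(slot_lt (ltnW tW)).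
Qed.

Lemma through t x : t < size W -> x.1 < t < x.2 -> x.1 \in back W x.2 -> x \in column t.
Proof.
case: x => u v /= tW /andP[ut tv] ub.
have : (u, v) \in slot t by apply: slot_mem ub _; rewrite ut ltnW.
rewrite /column slot_in // !mem_cat inE; case/or3P => [->|/mapP[w _ [_ E]]|->]; rewrite ?orbT //.
by rewrite E ltnn in tv.
Qed.

Lemma height_through t x : x.1 < t < x.2 -> height x t = index x (column t).
Proof. by case/andP => a b; rewrite /height ltn_eqF // gtn_eqF. Qed.

Lemma height_level t x : t < size W -> x.1 < t < x.2 -> x.1 \in back W x.2 -> height x t != level t.
Proof.
move=> tW xt xb; rewrite height_through //; apply/eqP => /(index_inj_in (through tW xt xb)) E.
by rewrite E /= ltnn in xt.
Qed.

Lemma height_inj t x y : t < size W -> x.1 < t < x.2 -> x.1 \in back W x.2 ->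
  y.1 < t < y.2 -> height x t = height y t -> x = y.
Proof. by move=> tW xt xb yt; rewrite !height_through //; apply: index_inj_in; exact: through. Qed.

(** Between [t] and [t.+1] both edges occur in [slot t.+1], in a fixed order, and contraction at
    either side preserves it weakly. Equality at both sides would force both edges to join [t] and
    [t.+1], hence to coincide, so one side is strict. *)
Lemma height_order t x y : t.+1 < size W -> x != y ->
  x.1 \in back W x.2 -> y.1 \in back W y.2 -> x.1 <= t < x.2 -> y.1 <= t < y.2 ->
  [\/ height x t <= height y t /\ height x t.+1 < height y t.+1,
      height x t < height y t /\ height x t.+1 <= height y t.+1,
      height y t <= height x t /\ height y t.+1 < height x t.+1 |
      height y t < height x t /\ height y t.+1 <= height x t.+1].
Proof.
move=> tW.
have key x' y' : x'.1 \in back W x'.2 -> y'.1 \in back W y'.2 -> x'.1 <= t < x'.2 -> y'.1 <= t < y'.2 ->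
   index x' (slot t.+1) < index y' (slot t.+1) ->
   height x' t <= height y' t /\ height x' t.+1 < height y' t.+1 \/
   height x' t < height y' t /\ height x' t.+1 <= height y' t.+1.
  move=> xb yb xt yt lt.
  have xs : x' \in slot t.+1 by rewrite (surjective_pairing x'); apply: slot_mem.
  have ys : y' \in slot t.+1 by rewrite (surjective_pairing y'); apply: slot_mem.
  have tW' := ltnW tW.
  have h1 : height x' t <= height y' t.
    rewrite !height_out // slot_out in lt *; rewrite /column.
    apply: index_collapse_mono => //; rewrite -?slot_out ?slot_uniq ?(ltnW tW') //; exact: diag_notin.
  have h2 : height x' t.+1 <= height y' t.+1.
    rewrite !height_in // slot_in // in lt *; rewrite /column.
    apply: index_collapse_mono => //; rewrite -?slot_in ?slot_uniq ?(ltnW tW) //; exact: diag_notin.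
  case: (ltngtP (height x' t) (height y' t)) h1 => // [l1 _|e1 _]; first by right.
  case: (ltngtP (height x' t.+1) (height y' t.+1)) h2 => // [l2 _|e2 _]; first by left.
  have ne : x' != y' by apply: contraTneq lt => ->; rewrite ltnn.
  have mcol (B : seq edge) (c : edge) (A1 A2 : seq edge) (z : edge) : z \in A1 ++ B ++ A2 -> collapse B c z \in A1 ++ c :: A2.
    rewrite /collapse; case: (boolP (z \in B)) => zB; first by rewrite [_ \in A1 ++ c :: A2]mem_cat mem_head orbT.
    by rewrite !mem_cat inE (negbTE zB) /= => /orP[->|->]; rewrite ?orbT.
  have mout z : z \in slot t.+1 -> collapse (emitted t) (t, t) z \in column t.
    by rewrite slot_out; exact: mcol.
  have mi z : z \in slot t.+1 -> collapse (taken t.+1) (t.+1, t.+1) z \in column t.+1.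
    by rewrite slot_in //; exact: mcol.
  rewrite !height_out // in e1; have {e1} := index_inj_in (mout _ xs) e1.
  rewrite !height_in // in e2; have {e2} := index_inj_in (mi _ xs) e2.
  rewrite /collapse !emittedE // !takenE //.
  case: (eqVneq x'.2 t.+1) => x2; case: (eqVneq y'.2 t.+1) => y2.
  - move=> _; case: (eqVneq x'.1 t) => x1; case: (eqVneq y'.1 t) => y1.
    + by case/eqP: ne; rewrite (surjective_pairing x') (surjective_pairing y') x1 x2 y1 y2.
    + by move=> E; rewrite -E eqxx in y1.
    + by move=> E; rewrite E eqxx in x1.
    + by move=> E; rewrite E eqxx in ne.
  - by move=> E; rewrite -E eqxx in y2.
  - by move=> E; rewrite E eqxx in x2.
  - by move=> E; rewrite E eqxx in ne.
move=> ne xb yb xt yt.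
have xs : x \in slot t.+1 by rewrite (surjective_pairing x); apply: slot_mem.
case: (ltngtP (index x (slot t.+1)) (index y (slot t.+1))) => lt.
- by case: (key x y) => // H; [constructor 1|constructor 2].
- by case: (key y x) => // H; [constructor 3|constructor 4].
- by case/eqP: ne; exact: index_inj_in xs lt.
Qed.
End Slots.

Require Import Defs.
From mathcomp Require Import all_boot all_order all_algebra.
From mathcomp Require Import all_classical all_reals all_analysis.
From mathcomp Require Import ring lra.

Import Order.TTheory GRing.Theory Num.Theory.
Import numFieldNormedType.Exports.

(** * Piecewise linear interpolation *)

Section Interpolation.
Local Open Scope ring_scope.
Variable R : realType.

(* The projection of the real line to [0, 1]. *)
Definition clamp (z : R) : R := (`|z| - `|z - 1| + 1) / 2.

Lemma clamp_le0 z : z <= 0 -> clamp z = 0.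
Proof. by move=> z0; rewrite /clamp !ler0_norm; lra. Qed.

Lemma clamp_ge1 z : 1 <= z -> clamp z = 1.
Proof. by move=> z0; rewrite /clamp !ger0_norm; lra. Qed.

Lemma clamp_mid z : 0 <= z <= 1 -> clamp z = z.
Proof. by move=> /andP[z0 z1]; rewrite /clamp ger0_norm // ler0_norm; lra. Qed.

Lemma clamp_continuous : continuous clamp.
Proof.
move=> z; apply: cvgM; last exact: cvg_cst.
apply: cvgD; last exact: cvg_cst.
apply: cvgB; first exact: norm_continuous.
by apply: cvg_norm; apply: cvgB; [exact: cvg_id | exact: cvg_cst].
Qed.

(** A sum of clamped increments instead of a definition by cases, so that continuity needs no
    gluing. *)
Fixpoint interp (h : nat -> R) n (x : R) : R :=
  if n is m.+1 then interp h m x + (h m.+1 - h m) * clamp (x - m%:R) else h 0%N.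

Lemma interp_ge h n x : n%:R <= x -> interp h n x = h n.
Proof.
elim: n => [|n IH] //= nx; rewrite -natr1 in nx.
by rewrite IH ?clamp_ge1; lra.
Qed.

Lemma interp_eval h n k x : (k < n)%N -> k%:R <= x <= k.+1%:R ->
  interp h n x = h k + (x - k%:R) * (h k.+1 - h k).
Proof.
elim: n => [|n IH] //=; rewrite ltnS leq_eqVlt => /orP[/eqP ->|kn] /andP[kx xk].
  by rewrite interp_ge // clamp_mid 1?mulrC //; rewrite -natr1 in xk; lra.
rewrite IH ?kx ?xk // clamp_le0 ?mulr0 ?addr0 //.
have : k.+1%:R <= n%:R :> R by rewrite ler_nat.
lra.
Qed.

Lemma interp_nat h n k : (k < n)%N -> interp h n k%:R = h k.
Proof. by move=> kn; rewrite (@interp_eval h n k) ?subrr ?mul0r ?addr0 // lexx ler_nat ltnW. Qed.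

Lemma interp_continuous h n : continuous (interp h n).
Proof.
elim: n => [|n IH] x /=; first exact: cvg_cst.
apply: cvgD; first exact: IH.
apply: cvgM; first exact: cvg_cst.
apply: (@continuous_comp _ _ _ (fun x : R => x - n%:R) clamp); last exact: clamp_continuous.
by apply: cvgB; [exact: cvg_id | exact: cvg_cst].
Qed.

(** The difference of two affine functions is a convex combination, with positive weights, of its
    end values: of equal sign in the weak sense and not both zero, they cannot cancel. *)
Lemma mix_neq (a a' b b' d : R) : 0 < d < 1 -> (a <= b /\ a' < b') \/ (a < b /\ a' <= b') ->
  a + d * (a' - a) <> b + d * (b' - b).
Proof.
move=> /andP[d0 d1] H E.
have E' : (1 - d) * (b - a) + d * (b' - a') = 0 by lra.
case: H => -[h1 h2].
  have : 0 <= (1 - d) * (b - a) by apply: mulr_ge0; lra.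
  have : 0 < d * (b' - a') by apply: mulr_gt0; lra.
  lra.
have : 0 < (1 - d) * (b - a) by apply: mulr_gt0; lra.
have : 0 <= d * (b' - a') by apply: mulr_ge0; lra.
lra.
Qed.

Lemma floor_ex (z : R) n : 0 <= z -> z < n%:R -> exists2 k, (k < n)%N & k%:R <= z < k.+1%:R.
Proof.
elim: n => [|n IH] z0 zn; first by move: zn; rewrite ltNge z0.
case: (ltP z n%:R) => [/(IH z0)[k kn H]|le]; last by exists n; rewrite ?le.
by exists k => //; exact: ltnW.
Qed.
End Interpolation.

(** * The graph of a word and its cycles *)

Section Graph.
Variable W : word.
Hypothesis wfW : well_formed W.

Definition word_adj : rel 'I_(size W) := fun u v => linked W u v.

Lemma word_adj_sym : symmetric word_adj. Proof. by move=> u v; exact: linked_sym. Qed.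

Lemma word_adj_irrefl : irreflexive word_adj.
Proof. by move=> u; apply/negP => /orP[] /back_lt; rewrite ltnn. Qed.

Definition word_graph := SGraph word_adj_sym word_adj_irrefl.

(** Every vertex other than 0 absorbs a strand and so has a smaller neighbour; the descent ends at
    0. *)
Lemma word_graph_connected : connected_graph word_graph.
Proof.
have root (u : word_graph) (lt0 : 0 < size W) : connect (@adj word_graph) u (Ordinal lt0).
  have [k] := ubnP (val u); elim: k u => // k IH u uk.
  case: (posnP (val u)) => [u0|u0].
    by have -> : u = Ordinal lt0 by apply: val_inj.
  have [_ _ /(_ u0)] := proj1 wfW _ (ltn_ord u).
  case Eb: (back W u) => [|w r] // _.
  have wb : w \in back W u by rewrite Eb mem_head.
  have /andP[wu _] := back_lt wb.
  apply: connect_trans (IH (Ordinal (ltn_trans wu (ltn_ord u))) _); last exact: leq_trans wu uk.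
  by apply: connect1; rewrite /= /word_adj /linked /= wb orbT.
move=> u v; have lt0 : 0 < size W by apply: leq_ltn_trans (ltn_ord u).
apply: connect_trans (root u lt0) _.
by rewrite (sym_connect_sym word_adj_sym); exact: root.
Qed.

Lemma pmap_insub (P : pred nat) (sT : subType P) (s : seq nat) : all P s ->
  exists t : seq sT, map val t = s.
Proof.
elim: s => [|x s IH] /=; first by exists [::].
by case/andP => Px /IH[t <-]; exists (Sub x Px :: t); rewrite /= SubK.
Qed.

Lemma cycle_val (T : Type) (f : T -> nat) (s : seq T) :
  cycle (linked W) (map f s) = cycle (fun x y => linked W (f x) (f y)) s.
Proof. by case: s => [|x s] //=; rewrite -map_rcons path_map. Qed.

Lemma closed_hamiltonian (u v : 'I_(size W)) : closed_conf (linked W) [:: val u; val v] (size W) ->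
  hamiltonian (del_vertices (G := word_graph) [set u; v]).
Proof.
case=> c [cyc pc sc].
have mc x : (x \in c) = (x \notin [:: val u; val v]) && (x < size W).
  by rewrite (perm_mem pc) mem_filter mem_iota add0n.
have [d Ed] : exists d : seq 'I_(size W), map val d = c.
  by apply: pmap_insub; apply/allP => x; rewrite mc => /andP[].
have [f Ef] : exists f : seq (del_vertex (G := word_graph) [set u; v]), map val f = d.
  have : all (fun x => x \notin [set u; v]%SET) d.
    apply/allP => x xd; have : val x \in c by rewrite -Ed map_f.
    by rewrite mc !inE => /andP[].
  elim: (d) => [|x s IH] /=; first by exists [::].
  by case/andP => Px /IH[t <-]; exists (Sub x Px :: t).
exists f; split.
- by rewrite -(size_map val) Ef -(size_map val) Ed.
- apply/andP; split.
    by move: cyc; rewrite -Ed -Ef -map_comp cycle_val.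
  have : uniq c by rewrite (perm_uniq pc) filter_uniq ?iota_uniq.
  by rewrite -Ed -Ef => /map_uniq /map_uniq.
- move=> x; rewrite -(mem_map val_inj) Ef -(mem_map val_inj) Ed mc ltn_ord andbT.
  by have := valP x; rewrite !inE.
Qed.

Lemma hamiltonian_closed : hamiltonian word_graph -> closed_conf (linked W) [::] (size W).
Proof.
case=> c [sc /andP[cyc uc] mc]; exists (map val c); split.
- by rewrite cycle_val.
- rewrite /undeleted filter_predT; apply: uniq_perm; rewrite ?iota_uniq //.
    by rewrite map_inj_uniq //; exact: val_inj.
  move=> x; rewrite mem_iota add0n /=; apply/mapP/idP => [[y _ ->]|xn]; first exact: ltn_ord.
  by exists (Ordinal xn).
- by rewrite size_map.
Qed.

(** * Drawing the edges as polygonal lines *)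

Section Drawing.
Local Open Scope ring_scope.
Local Open Scope classical_set_scope.
Variable R : realType.
Notation n := (size W).

Definition pos (v : nat) : R * R := (v%:R, (level W v)%:R).
(** Outside the span of an edge the interpolated heights are default values of [index], but for a
    parameter in [0, 1] the arc stays over the span. *)
Definition curve (x : nat * nat) (z : R) : R := interp (fun t => (height W x t)%:R) n z.
Definition abscissa (u v : nat) (s : R) : R := u%:R + s * (v%:R - u%:R).
(** With [minn] and [maxn] the curve belongs to the unordered edge: the two orientations share it
    and differ only in the abscissa, an affine function of the parameter. *)
Definition arc (u v : nat) (s : R) : R * R :=
  (abscissa u v s, curve (minn u v, maxn u v) (abscissa u v s)).

Lemma linked_edge u v : linked W u v -> [/\ minn u v \in back W (maxn u v), (minn u v < maxn u v)%N & (maxn u v < n)%N].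
Proof.
case/orP => H; have /andP[lt ltn] := back_lt H.
  by rewrite (minn_idPl (ltnW lt)) (maxn_idPr (ltnW lt)).
by rewrite (minn_idPr (ltnW lt)) (maxn_idPl (ltnW lt)).
Qed.

Lemma abscissa_between u v s : u != v -> 0 < s < 1 ->
  (minn u v)%:R < abscissa u v s < (maxn u v)%:R.
Proof.
rewrite neq_ltn => /orP[] lt /andP[s0 s1].
  have lt' : u%:R < v%:R :> R by rewrite ltr_nat.
  have h1 : 0 < s * (v%:R - u%:R) :> R by apply: mulr_gt0; lra.
  have h2 : 0 < (1 - s) * (v%:R - u%:R) :> R by apply: mulr_gt0; lra.
  by rewrite (minn_idPl (ltnW lt)) (maxn_idPr (ltnW lt)) /abscissa; apply/andP; split; lra.
have lt' : v%:R < u%:R :> R by rewrite ltr_nat.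
have h1 : 0 < s * (u%:R - v%:R) :> R by apply: mulr_gt0; lra.
have h2 : 0 < (1 - s) * (u%:R - v%:R) :> R by apply: mulr_gt0; lra.
by rewrite (minn_idPr (ltnW lt)) (maxn_idPl (ltnW lt)) /abscissa; apply/andP; split; lra.
Qed.

Lemma curve_nat x k : (k < n)%N -> curve x k%:R = (height W x k)%:R.
Proof. by move=> kn; rewrite /curve interp_nat. Qed.

(** Over the interior of a unit interval both curves are affine and [height_order] separates them;
    over an integer the heights are positions in one column, and different strands have different
    positions. *)
Lemma curve_neq x y z : x != y -> x.1 \in back W x.2 -> y.1 \in back W y.2 ->
  x.1%:R < z < x.2%:R -> y.1%:R < z < y.2%:R -> curve x z <> curve y z.
Proof.
move=> ne xb yb /andP[xz zx] /andP[yz zy].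
have /andP[_ xW] := back_lt xb; have /andP[_ yW] := back_lt yb.
have z0 : 0 <= z by apply: ltW; apply: le_lt_trans xz.
have zn : z < n%:R by apply: lt_trans zx _; rewrite ltr_nat.
have [k kn /andP[kz zk]] := floor_ex z0 zn.
have ltk (a : nat) : a%:R < z -> (a <= k)%N.
  by move=> az; rewrite -ltnS -(ltr_nat R); exact: lt_trans zk.
have gtk (a : nat) : z < a%:R -> (k < a)%N.
  by move=> za; rewrite -(ltr_nat R); exact: le_lt_trans za.
case: (ltgtP k%:R z) kz => // [kz _|kz _].
  have kn1 : (k.+1 < n)%N by apply: leq_ltn_trans xW; exact: gtk.
  rewrite /curve !(@interp_eval _ _ n k) ?(ltW kz) ?(ltW zk) //.
  have d01 : 0 < z - k%:R < 1 by move: zk; rewrite -natr1; lra.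
  have [||[h1 h2]|[h1 h2]|[h1 h2]|[h1 h2]] := height_order wfW kn1 ne xb yb; rewrite ?ltk ?gtk //.
  - by apply: mix_neq => //; left; rewrite ler_nat ltr_nat.
  - by apply: mix_neq => //; right; rewrite ler_nat ltr_nat.
  - by apply/nesym/mix_neq => //; left; rewrite ler_nat ltr_nat.
  - by apply/nesym/mix_neq => //; right; rewrite ler_nat ltr_nat.
rewrite -kz in xz zx yz zy *; rewrite !curve_nat // => /eqP; rewrite eqr_nat => /eqP E.
by case/eqP: ne; apply: (height_inj wfW kn _ xb _ E); rewrite -!(ltr_nat R) ?xz ?zx ?yz ?zy.
Qed.

Lemma curve_vertex x w : (w < n)%N -> x.1 \in back W x.2 -> x.1%:R < (w%:R : R) < x.2%:R ->
  curve x w%:R <> (level W w)%:R.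
Proof.
move=> wn xb; rewrite !ltr_nat => xw; rewrite curve_nat // => /eqP; rewrite eqr_nat => /eqP E.
by have := height_level wfW wn xw xb; rewrite E eqxx.
Qed.

Lemma curve_ends u v w : linked W u v -> (w == u) || (w == v) -> curve (minn u v, maxn u v) w%:R = (level W w)%:R.
Proof.
move=> uv Hw; have [_ lt ltn] := linked_edge uv.
have wn : (w < n)%N by apply: leq_ltn_trans ltn; case/orP: Hw => /eqP ->; rewrite ?leq_maxl ?leq_maxr.
have : (w == minn u v) || (w == maxn u v) by case/orP: Hw => /eqP ->; rewrite /minn /maxn; case: ltnP => _; rewrite eqxx ?orbT.
rewrite curve_nat // => /orP[]/eqP ->; first by rewrite (@height_start W (minn u v, maxn u v)).
by rewrite (@height_end W (minn u v, maxn u v)).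
Qed.

Lemma arc_continuity u v : continuous (arc u v).
Proof.
have ca : continuous (abscissa u v).
  by move=> s; apply: cvgD; [exact: cvg_cst | apply: cvgM; [exact: cvg_id | exact: cvg_cst]].
move=> s; have cc : curve (minn u v, maxn u v) \o abscissa u v @ s --> curve (minn u v, maxn u v) (abscissa u v s).
  by apply: (@continuous_comp _ _ _ (abscissa u v)); [exact: ca | exact: interp_continuous].
exact: (cvg_pair (ca s) cc).
Qed.

Lemma word_graph_planar : planar R word_graph.
Proof.
exists (fun v => pos (val v)), (fun u v => arc (val u) (val v)).
have ne (u v : word_graph) : adj u v -> val u != val v.
  by move=> uv; apply/eqP => /val_inj E; move: uv; rewrite E adj_irrefl.
split.
- move=> u v [/eqP]; rewrite eqr_nat => /eqP E _; exact: val_inj.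
- move=> u v uv; rewrite /arc /abscissa mul0r addr0 /pos.
  by rewrite (curve_ends (w := val u)) ?eqxx.
- move=> u v uv; rewrite /arc /abscissa mul1r addrC subrK /pos.
  by rewrite (curve_ends (w := val v)) ?eqxx ?orbT.
- move=> u v uv t _; rewrite /arc minnC maxnC.
  have -> : abscissa (val v) (val u) t = abscissa (val u) (val v) (1 - t) by rewrite /abscissa; ring.
  by [].
- by move=> u v uv; apply: continuous_subspaceT; exact: arc_continuity.
- move=> u v uv s t _ _ [/addrI E _]; apply: mulIf E.
  by rewrite subr_eq0 eqr_nat eq_sym ne.
- move=> u v uv t w t01 [Ew E].
  have [eb _ _] := linked_edge uv.
  have := abscissa_between (ne _ _ uv) t01; rewrite Ew => H.
  by rewrite Ew in E; exact: (@curve_vertex (_, _) _ (ltn_ord w) eb H E).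
- move=> u v x y uv xy sne s t s01 t01 [Ez E].
  have [eb1 _ _] := linked_edge uv; have [eb2 _ _] := linked_edge xy.
  have H1 := abscissa_between (ne _ _ uv) s01; have H2 := abscissa_between (ne _ _ xy) t01.
  rewrite -Ez in H2 E; apply: (@curve_neq (_, _) (_, _) _ _ eb1 eb2 H1 H2 E).
  apply: contra sne => /eqP[E1 E2].
  have : (val u = val x /\ val v = val y) \/ (val u = val y /\ val v = val x).
    have {}E1 : minn (val u) (val v) = minn (val x) (val y) by exact: E1.
    have {}E2 : maxn (val u) (val v) = maxn (val x) (val y) by exact: E2.
    by move: E1 E2; clear; move: (val u) (val v) (val x) (val y) => a b c d; lia.
  by case=> -[/val_inj -> /val_inj ->] //; rewrite finset.setUC.
Qed.
End Drawing.
End Graph.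

(** Of the two ends of an edge one is in [back] of the other, so [served] meets every edge in one of
    its two orders. Soundness turns the closed state into a cycle, and completeness turns a
    hamiltonian cycle into the excluded run. *)
Lemma chain_word_K2_hypohamiltonian W : chain_word W -> K2_hypohamiltonian (word_graph W).
Proof.
case=> wfW sW nW; split.
  have del (u w : 'I_(size W)) : val u \in back W w -> hamiltonian (del_vertices (G := word_graph W) [set u; w]).
    move=> uw; have [s] := sW _ _ (ltn_ord w) uw; rewrite inE => /eqP -> r.
    apply: closed_hamiltonian.
    have : reach [:: val u; val w] 0 (take (size W) W) (Some [::]) None by rewrite take_size.
    by move/(reach_sound wfW (leqnn _)).
  by move=> u w /orP[/del//|/del]; rewrite finset.setUC.
move=> /hamiltonian_closed H; apply: nW; apply: reach_closed => //.
by case: H => c [_ pc sc]; move: sc; rewrite (perm_size pc) /undeleted filter_predT size_iota; case: (size W).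
Qed.

Theorem theorem3 (R : realType) (n : nat) (hn : (134 <= n)%N) :
  exists G : sgraph,
    [/\ #|G| = n, connected_graph G, planar R G & K2_hypohamiltonian G].
Proof.
have [W [sW cW]] := chain_exists hn; have [wfW _ _] := cW.
exists (word_graph W); split.
- by rewrite /= card_ord.
- exact: word_graph_connected.
- exact: word_graph_planar.
- exact: chain_word_K2_hypohamiltonian.
Qed.
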